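(* Let $\Pi,\Pi'$ be two independent Poisson processes of unit intensity on $\mathbb{R}^d$, and consider any translation-invariant random perfect matching $M$ between the points of $\Pi'$ and the points of $\Pi$. If $d=1$ or $d=2$, then the total distance $$L=\iint \|x-y\|\,\mathbf{1}[x\in[0,1)^d]\,M(dx,dy)$$ from points in $[0,1)^d$ to the points they are matched to satisfies $$\mathbf{E}L^{d/2}=\infty.$$
   Context: $\|\cdot\|$ is the Euclidean norm. A translation-invariant random perfect matching between the points of $\Pi'$ and of $\Pi$ is a simple point process $M$ on $\mathbb{R}^d\times\mathbb{R}^d$ whose law is invariant under the diagonal action of translations of $\mathbb{R}^d$, and whose marginals are $M(\cdot\times\mathbb{R}^d)=\Pi'(\cdot)$ and $M(\mathbb{R}^d\times\cdot)=\Pi(\cdot)$. An atom of $M$ at $(x,y)$ means that the point $x$ of $\Pi'$ is matched to the point $y$ of $\Pi$. Thus $L$ is the sum, over points $x$ of $\Pi'$ in $[0,1)^d$, of the distance from $x$ to its partner in $\Pi$. *)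

(* Defs.v *)
From HB Require Import structures.
From mathcomp Require Import all_boot all_order all_algebra.
From mathcomp Require Import all_classical all_reals all_analysis.
From mathcomp Require Import measurable_realfun.

Set Implicit Arguments.
Unset Strict Implicit.
Unset Printing Implicit Defensive.

Import Order.TTheory GRing.Theory Num.Theory.
Import numFieldNormedType.Exports.

Local Open Scope classical_set_scope.
Local Open Scope ring_scope.

(** [R^d] is [d.-tuple R] with the library's product sigma-algebra of the Borel
    sigma-algebra of [R]. *)

Definition tadd (R : realType) (d : nat) (x y : d.-tuple R) : d.-tuple R :=
  [tuple tnth x i + tnth y i | i < d].

Definition tsub (R : realType) (d : nat) (x y : d.-tuple R) : d.-tuple R :=
  [tuple tnth x i - tnth y i | i < d].

Definition enorm (R : realType) (d : nat) (x : d.-tuple R) : R :=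
  Num.sqrt (\sum_(i < d) tnth x i ^+ 2).

Definition unit_cube (R : realType) (d : nat) : set (d.-tuple R) :=
  [set x | forall i, 0 <= tnth x i < 1].

Definition bounded_region (R : realType) (d : nat) (A : set (d.-tuple R)) :=
  exists r : R, forall x, A x -> enorm x <= r.

Definition bounded_region2 (R : realType) (d : nat)
    (A : set (d.-tuple R * d.-tuple R)%type) :=
  exists r : R, forall p, A p -> enorm p.1 <= r /\ enorm p.2 <= r.

(** Lebesgue measure on [R^n]: the iterated product of [lebesgue_measure],
    transported along [(x, t) |-> x :: t]. [measurableTypeR R], on which
    [lebesgue_measure] is declared, has the same measurable sets as [R] but a
    different display. *)

Definition tcons (R : realType) (n : nat) (p : measurableTypeR R * n.-tuple R) :
  n.+1.-tuple R := [tuple of (p.1 : R) :: p.2].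

Definition tuncons (R : realType) (n : nat) (t : n.+1.-tuple R) :
  measurableTypeR R * n.-tuple R := (thead t, [tuple of behead t]).

Lemma tconsK (R : realType) (n : nat) : cancel (@tcons R n) (@tuncons R n).
Proof.
by move=> [x t]; rewrite /tuncons /tcons theadE; congr (_, _); exact/val_inj.
Qed.

Lemma measurable_tcons (R : realType) (n : nat) :
  measurable_fun [set: (measurableTypeR R * n.-tuple R)%type] (@tcons R n).
Proof.
apply: (@measurable_cons _ _ _ _
  (fun p : measurableTypeR R * n.-tuple R => p.1 : R)) => //.
by move=> _ Y mY; exact: measurable_fst.
Qed.

Lemma measurable_tuncons (R : realType) (n : nat) :
  measurable_fun [set: n.+1.-tuple R] (@tuncons R n).
Proof.
apply: measurable_fun_pair; last exact: measurable_behead.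
by move=> _ Y mY; exact: measurable_tnth.
Qed.

Section tcons_measure.
Context (R : realType) (n : nat).
Variable m : {sigma_finite_measure set (n.-tuple R) -> \bar R}.

Definition tcons_measure : set (n.+1.-tuple R) -> \bar R :=
  pushforward (@lebesgue_measure R \x m)%E (@tcons R n).

Let tcons_preimage A : measurable A -> measurable (@tcons R n @^-1` A).
Proof.
by move=> mA; rewrite -[X in measurable X]setTI; exact: measurable_tcons.
Qed.

Let tcons_measure0 : tcons_measure set0 = 0%E.
Proof. by rewrite /tcons_measure /pushforward preimage_set0 measure0. Qed.

Let tcons_measure_ge0 A : (0 <= tcons_measure A)%E.
Proof. by rewrite /tcons_measure /pushforward measure_ge0. Qed.

Let tcons_measure_sigma_additive : semi_sigma_additive tcons_measure.
Proof.
move=> F mF tF mUF; rewrite /tcons_measure /pushforward preimage_bigcup.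
apply: measure_semi_sigma_additive.
- by move=> i; exact: tcons_preimage.
- apply/trivIsetP => i j _ _ ij; rewrite -preimage_setI.
  by move/trivIsetP : tF => /(_ _ _ _ _ ij) ->//; rewrite preimage_set0.
- by rewrite -preimage_bigcup; exact: tcons_preimage.
Qed.

HB.instance Definition _ := isMeasure.Build _ _ _ tcons_measure
  tcons_measure0 tcons_measure_ge0 tcons_measure_sigma_additive.

Let tcons_measure_sigma_finite : sigma_finite setT tcons_measure.
Proof.
have /sigma_finiteP[F [FT ndF Foo]] := sigma_finiteT (@lebesgue_measure R).
have /sigma_finiteP[G [GT ndG Goo]] := sigma_finiteT m.
exists (fun k => @tuncons R n @^-1` (F k `*` G k)).
  rewrite -preimage_bigcup (_ : \bigcup_k (F k `*` G k) = setT) ?preimage_setT//.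
  rewrite -subTset => -[x y] _.
  have [i _ Fix] : (\bigcup_k F k) x by rewrite -FT.
  have [j _ Gjy] : (\bigcup_k G k) y by rewrite -GT.
  exists (maxn i j) => //; split => /=.
    by move: x Fix; exact/subsetPset/ndF/leq_maxl.
  by move: y Gjy; exact/subsetPset/ndG/leq_maxr.
move=> k; have [mF Fk] := Foo k; have [mG Gk] := Goo k; split.
  rewrite -[X in measurable X]setTI; apply: measurable_tuncons => //.
  exact: measurableX.
rewrite /tcons_measure /pushforward -comp_preimage.
rewrite (_ : @tuncons R n \o @tcons R n = id); last first.
  by apply/funext => p /=; rewrite tconsK.
by rewrite preimage_id product_measure1E// lte_mul_pinfty// ge0_fin_numE.
Qed.

HB.instance Definition _ := @Measure_isSigmaFinite.Build _ _ _ tcons_measure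
  tcons_measure_sigma_finite.

End tcons_measure.

Fixpoint lebesgue_tuple (R : realType) (n : nat) :
    {sigma_finite_measure set (n.-tuple R) -> \bar R} :=
  match n with
  | 0 => dirac ([tuple] : 0.-tuple R)
  | n'.+1 => tcons_measure (lebesgue_tuple R n')
  end.

(** A random measure on [T] is a kernel from the probability space to [T].
    Its law is a probability on the space of measures on [T], equipped with the
    sigma-algebra generated by the evaluations [mu |-> mu A], [A] measurable. *)

Definition config_event (R : realType) (dT : measure_display)
    (T : measurableType dT) : set (set {measure set T -> \bar R}) :=
  <<s \bigcup_(A in @measurable dT T)
        preimage_set_system [set: {measure set T -> \bar R}]
          (fun mu : {measure set T -> \bar R} => mu A)
          (@measurable _ (\bar R)) >>.

Definition law (R : realType) (dO : measure_display)
    (Omega : measurableType dO) (P : probability Omega R)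
    (dT : measure_display) (T : measurableType dT)
    (N : Omega -> {measure set T -> \bar R})
    (C : set {measure set T -> \bar R}) : \bar R :=
  P (N @^-1` C).

Definition same_law (R : realType) (dO : measure_display)
    (Omega : measurableType dO) (P : probability Omega R)
    (dT : measure_display) (T : measurableType dT)
    (N N' : Omega -> {measure set T -> \bar R}) : Prop :=
  forall C, config_event C -> law P N C = law P N' C.

Definition independent_processes (R : realType) (dO : measure_display)
    (Omega : measurableType dO) (P : probability Omega R)
    (dT : measure_display) (T : measurableType dT)
    (N N' : Omega -> {measure set T -> \bar R}) : Prop :=
  forall C C', config_event C -> config_event C' ->
    P (N @^-1` C `&` N' @^-1` C') = (P (N @^-1` C) * P (N' @^-1` C'))%E.

(** Taking [C i = setT] for some of the indices gives the product rule for every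
    subfamily. *)
Definition independent_variables (R : realType) (dO : measure_display)
    (Omega : measurableType dO) (P : probability Omega R)
    (m : nat) (X : 'I_m -> Omega -> \bar R) : Prop :=
  forall C : 'I_m -> set (\bar R), (forall i, measurable (C i)) ->
    P (\bigcap_i (X i @^-1` C i)) = (\prod_(i < m) P (X i @^-1` C i))%E.

(** [bdd] is the family of bounded sets of [T]. A point process is a random
    measure that is almost surely integer-valued on bounded sets; it is simple
    if almost surely it has no multiple point. *)

Definition point_process (R : realType) (dO : measure_display)
    (Omega : measurableType dO) (P : probability Omega R)
    (dT : measure_display) (T : measurableType dT) (bdd : set (set T))
    (N : R.-ker Omega ~> T) : Prop :=
  {ae P, forall w, forall B : set T, measurable B -> bdd B ->
    exists k : nat, N w B = k%:R%:E}.

Definition simple_point_process (R : realType) (dO : measure_display)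
    (Omega : measurableType dO) (P : probability Omega R)
    (dT : measure_display) (T : measurableType dT) (bdd : set (set T))
    (N : R.-ker Omega ~> T) : Prop :=
  point_process P bdd N /\
  {ae P, forall w, forall x : T, (N w [set x] <= 1)%E}.

(** The second argument of [poisson_prob] is not used in its definition;
    rate [0] gives the Dirac mass at [0]. *)
Definition unit_poisson_process (R : realType) (dO : measure_display)
    (Omega : measurableType dO) (P : probability Omega R) (d : nat)
    (N : R.-ker Omega ~> d.-tuple R) : Prop :=
  [/\ point_process P (@bounded_region R d) N,
      forall B : set (d.-tuple R), measurable B -> bounded_region B ->
        forall k : nat, P [set w | N w B = k%:R%:E] =
          poisson_prob (fine (lebesgue_tuple R d B)) 0%N [set k]
    & forall (m : nat) (B : 'I_m -> set (d.-tuple R)),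
        (forall i, measurable (B i)) -> (forall i, bounded_region (B i)) ->
        trivIset setT B ->
        independent_variables P (fun i w => N w (B i)) ].

Definition diag_shift (R : realType) (d : nat) (z : d.-tuple R)
    (p : d.-tuple R * d.-tuple R) : d.-tuple R * d.-tuple R :=
  (tadd p.1 z, tadd p.2 z).

Lemma measurable_tadd (R : realType) (d : nat) (z : d.-tuple R) :
  measurable_fun [set: d.-tuple R] (@tadd R d ^~ z).
Proof.
apply/measurable_fun_tnthP => i.
rewrite (_ : _ \o _ = fun x : d.-tuple R => tnth x i + tnth z i).
  by apply: measurable_funD => //; exact: measurable_tnth.
by apply/funext => x /=; rewrite tnth_mktuple.
Qed.

Lemma measurable_diag_shift (R : realType) (d : nat) (z : d.-tuple R) :
  measurable_fun [set: (d.-tuple R * d.-tuple R)%type] (diag_shift z).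
Proof.
by apply: measurable_fun_pair;
  apply: (measurableT_comp (measurable_tadd z)).
Qed.

Section shift_measure.
Context (R : realType) (d : nat).
Variables (z : d.-tuple R)
  (mu : {measure set (d.-tuple R * d.-tuple R)%type -> \bar R}).

Definition shift_measure : set (d.-tuple R * d.-tuple R)%type -> \bar R :=
  pushforward mu (diag_shift z).

Let shift_measure0 : shift_measure set0 = 0%E.
Proof. by rewrite /shift_measure /pushforward preimage_set0 measure0. Qed.

Let shift_measure_ge0 A : (0 <= shift_measure A)%E.
Proof. by rewrite /shift_measure /pushforward measure_ge0. Qed.

Let shift_measure_sigma_additive : semi_sigma_additive shift_measure.
Proof.
move=> F mF tF mUF; rewrite /shift_measure /pushforward preimage_bigcup.
have mpre A : measurable A -> measurable (diag_shift z @^-1` A).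
  by move=> mA; rewrite -[X in measurable X]setTI; exact: measurable_diag_shift.
apply: measure_semi_sigma_additive.
- by move=> i; exact: mpre.
- apply/trivIsetP => i j _ _ ij; rewrite -preimage_setI.
  by move/trivIsetP : tF => /(_ _ _ _ _ ij) ->//; rewrite preimage_set0.
- by rewrite -preimage_bigcup; exact: mpre.
Qed.

HB.instance Definition _ := isMeasure.Build _ _ _ shift_measure
  shift_measure0 shift_measure_ge0 shift_measure_sigma_additive.

End shift_measure.

(** [M] matches the points of [N1] (first coordinate) with those of [N2] (second
    coordinate). *)
Definition translation_invariant_matching (R : realType) (dO : measure_display)
    (Omega : measurableType dO) (P : probability Omega R) (d : nat)
    (N1 N2 : R.-ker Omega ~> d.-tuple R)
    (M : R.-ker Omega ~> (d.-tuple R * d.-tuple R)%type) : Prop :=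
  [/\ simple_point_process P (@bounded_region2 R d) M,
      forall z : d.-tuple R, same_law P (fun w => shift_measure z (M w)) M,
      {ae P, forall w, forall A : set (d.-tuple R), measurable A ->
        M w (A `*` setT) = N1 w A}
    & {ae P, forall w, forall A : set (d.-tuple R), measurable A ->
        M w (setT `*` A) = N2 w A} ].

Definition total_distance (R : realType) (d : nat)
    (mu : {measure set (d.-tuple R * d.-tuple R)%type -> \bar R}) : \bar R :=
  (\int[mu]_p (enorm (tsub p.1 p.2) * \1_(@unit_cube R d) p.1)%:E)%E.

(* Main.v *)
Require Import Defs.
From HB Require Import structures.
From mathcomp Require Import all_boot all_order all_algebra.
From mathcomp Require Import all_classical all_reals all_analysis.
From mathcomp Require Import measurable_realfun.
From mathcomp Require Import ring lra zify.

(** Suppose that the moment in the theorem is finite. In a box of volume [n^d] the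
    number of points of [Pi'] minus the number of points of [Pi] is a difference of
    two independent Poisson variables of mean [n^d]. No weight of the Poisson
    distribution of mean [m^2] exceeds [2 / m] ([poisson_pmf_bound]), so this
    discrepancy is of order at least [n^(d/2)] with probability bounded below
    ([difference_large], [difference_positive]). It has to be matched across the
    boundary of the box, and a finite moment does not allow for that many crossings.

    Dimension one. A positive discrepancy of [[0, n)] is at most the number of edges
    that leave the segment. An edge that leaves it from the [k]-th unit cell is at
    least [min (k, n - 1 - k)] long, so the total distance from this cell is at least
    as large; and with high probability no cell contains more than a multiple of
    [log n] points. Hence the sum of [P (L >= j)] over [j < n] is at least a multiple
    of [sqrt n / log n] ([segment_discrepancy], [tail_sum]). For [n = 256 * 4^s],
    multiply by [2^-s] and sum over [s]: the left-hand sides add up to at most a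
    multiple of [1 + E sqrt L] ([dyadic_min_sum]), whereas the right-hand sides form a
    harmonic series.

    Dimension two. If [E L] is finite, then the mean number of edges that cross a unit
    segment is finite ([crossing_X2_up] and its companions), but this only bounds the
    number of edges that cross the boundary of [[0, n)^2] by a multiple of [n], which is
    the order of the discrepancy; the gain comes from cancellation. Each edge is
    replaced by a horizontal path followed by a vertical one. The net flows through the
    unit segments of the integer grid are then two stationary integrable fields, whose
    divergence is the discrepancy ([divergence]). The averages [S_n] of such a field
    along a line form a Cauchy sequence in probability ([avg_cauchy]): for the strictly
    convex function [psi s = sqrt (1 + s^2)] the means of [psi S_n] tend to their
    infimum, whereas the mean of [psi] at the midpoint of [S_n] and [S_m] is not below
    this infimum, and strict convexity forces [S_n - S_m] to be small. On two parallel
    lines the limits agree: the difference of the flows through the long sides of a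
    rectangle of fixed width is its discrepancy, which is small compared to its length
    by Chebyshev's inequality, up to the flow through the short sides, which is bounded
    in mean ([flow_lln]). So the flows through opposite sides of [[0, n)^2] cancel up to
    [o(n)], against the lower bound for the discrepancy ([no_balanced_flow]). *)

Set Implicit Arguments.
Unset Strict Implicit.
Unset Printing Implicit Defensive.

Import Order.TTheory GRing.Theory Num.Theory.
Import numFieldNormedType.Exports.

Local Open Scope classical_set_scope.
Local Open Scope ring_scope.

(** * Expectations of nonnegative functions *)

Section expectation_toolkit.
Context (R : realType) (dO : measure_display) (Omega : measurableType dO)
  (P : {measure set Omega -> \bar R}).
Implicit Types f g : Omega -> R.

Local Notation E f := (\int[P]_w (f w)%:E)%E.
Local Notation mfun f := (measurable_fun [set: Omega] f).

Lemma expect_le f g : mfun f -> mfun g -> (forall w, 0 <= f w) ->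
  (forall w, f w <= g w) -> (E f <= E g)%E.
Proof.
move=> mf mg f0 fg; apply: ge0_le_integral => //.
- by move=> w _; rewrite lee_fin.
- exact/measurable_EFinP.
- exact/measurable_EFinP.
- by move=> w _; rewrite lee_fin.
Qed.

Lemma expectD f g : mfun f -> mfun g -> (forall w, 0 <= f w) ->
  (forall w, 0 <= g w) -> (E (fun w => f w + g w)%R = E f + E g)%E.
Proof.
move=> mf mg f0 g0; under eq_integral do rewrite EFinD.
rewrite ge0_integralD //; try (by move=> w _; rewrite lee_fin);
  exact/measurable_EFinP.
Qed.

Lemma expectZ f (k : R) : mfun f -> (forall w, 0 <= f w) -> 0 <= k ->
  (E (fun w => k * f w)%R = k%:E * E f)%E.
Proof.
move=> mf f0 k0; under eq_integral do rewrite EFinM.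
rewrite ge0_integralZl //; try (by move=> w _; rewrite lee_fin).
exact/measurable_EFinP.
Qed.

Lemma expect_sum (f : nat -> Omega -> R) n : (forall i, mfun (f i)) ->
  (forall i w, 0 <= f i w) ->
  (E (fun w => \sum_(i < n) f i w)%R = \sum_(i < n) E (f i))%E.
Proof.
move=> mf f0; under eq_integral do rewrite -sumEFin.
rewrite (@ge0_integral_sum _ _ _ P setT _ 'I_n (fun i w => (f i w)%:E)) //.
- by move=> i; exact/measurable_EFinP.
- by move=> i w _; rewrite lee_fin.
Qed.

Lemma measurable_ge f (c : R) : mfun f -> measurable [set w | c <= f w].
Proof.
move=> mf; rewrite -[X in measurable X]setTI.
have -> : [set w | c <= f w] = f @^-1` `[c, +oo[%classic.
  by apply/seteqP; split=> w /=; rewrite in_itv/= andbT.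
exact: mf.
Qed.

Lemma markov_expect f (c : R) : mfun f -> (forall w, 0 <= f w) -> 0 < c ->
  (c%:E * P [set w | (c <= f w)%R] <= E f)%E.
Proof.
move=> mf f0 c0.
set S := [set w | c <= f w].
have mS : measurable S by exact: measurable_ge.
have m1 : mfun (\1_S : Omega -> R) by exact: measurable_indic.
have -> : (c%:E * P S = E (fun w => c * \1_S w)%R)%E.
  rewrite (@expectZ (\1_S)) //; last exact: ltW.
  by rewrite integral_indic // setIT.
apply: expect_le => //.
- exact: measurable_funM.
- by move=> w; rewrite mulr_ge0 // ltW.
- move=> w; rewrite indicE; case: (boolP (w \in _)); last by rewrite mulr0.
  by rewrite inE /S /= mulr1.
Qed.

Lemma prob_ge_le f (c e : R) : mfun f -> (forall w, 0 <= f w) -> 0 < c ->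
  (E f <= (c * e)%:E)%E -> (P [set w | (c <= f w)%R] <= e%:E)%E.
Proof.
move=> mf f0 c0 fe; have := le_trans (markov_expect mf f0 c0) fe.
by rewrite EFinM lee_pmul2l // lte_fin.
Qed.

End expectation_toolkit.

Lemma expect_cst (R : realType) (dO : measure_display)
    (Omega : measurableType dO) (P : probability Omega R) (c : R) :
  (\int[P]_w c%:E = c%:E)%E.
Proof.
by have := integral_cst P measurableT c%:E; rewrite /cst => ->; rewrite [X in (_ * X)%E]probability_setT mule1.
Qed.

(** * A strictly convex function *)

Section japanese_bracket.
Context (R : realType).
Implicit Types s t : R.

(** The function [s |-> sqrt (1 + s^2)]: strictly convex and 1-Lipschitz, so that
    it measures convergence in probability of variables that are only known to be
    integrable. *)
Definition bracket s : R := Num.sqrt (1 + s ^+ 2).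

Lemma bracket_sqr s : bracket s ^+ 2 = 1 + s ^+ 2.
Proof. by rewrite sqr_sqrtr // addr_ge0 // sqr_ge0. Qed.

Lemma bracket_ge1 s : 1 <= bracket s.
Proof. by rewrite -sqrtr1 ler_sqrt ?lerDl ?sqr_ge0 // addr_ge0 ?sqr_ge0. Qed.

Lemma bracket_ge0 s : 0 <= bracket s.
Proof. exact: sqrtr_ge0. Qed.

Lemma bracket_le s : bracket s <= 1 + `|s|.
Proof.
have h : 0 <= 1 + `|s| by rewrite addr_ge0.
rewrite -(ler_pXn2r (n := 2)) ?nnegrE ?bracket_ge0 // bracket_sqr.
rewrite sqrrD expr1n mul1r -(real_normK (num_real s)).
by rewrite lerD2r lerDl mulrn_wge0.
Qed.

(** Minkowski's inequality for the vectors [(x, y)] and [(u, v)]. *)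
Lemma sqrt_minkowski (x y u v : R) : Num.sqrt ((x + u) ^+ 2 + (y + v) ^+ 2) <=
  Num.sqrt (x ^+ 2 + y ^+ 2) + Num.sqrt (u ^+ 2 + v ^+ 2).
Proof.
set a := Num.sqrt (x ^+ 2 + _); set b := Num.sqrt (u ^+ 2 + _).
have a0 : 0 <= a by exact: sqrtr_ge0.
have b0 : 0 <= b by exact: sqrtr_ge0.
have a2 : a ^+ 2 = x ^+ 2 + y ^+ 2 by rewrite sqr_sqrtr // addr_ge0 ?sqr_ge0.
have b2 : b ^+ 2 = u ^+ 2 + v ^+ 2 by rewrite sqr_sqrtr // addr_ge0 ?sqr_ge0.
have cs : x * u + y * v <= a * b.
  apply: (le_trans (ler_norm _)).
  rewrite -(ler_pXn2r (n := 2)) ?nnegrE ?mulr_ge0 //.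
  rewrite real_normK ?num_real // exprMn a2 b2.
  have := sqr_ge0 (x * v - y * u); nra.
rewrite -(ler_pXn2r (n := 2)) ?nnegrE ?sqrtr_ge0 ?addr_ge0 //.
rewrite sqr_sqrtr ?addr_ge0 ?sqr_ge0 // [leRHS]sqrrD a2 b2; nra.
Qed.

Lemma bracket_lip s t : bracket s <= bracket t + `|s - t|.
Proof.
have := sqrt_minkowski 1 t 0 (s - t).
rewrite addr0 subrKC expr0n add0r expr1n sqrtr_sqr; exact.
Qed.

(** Jensen's inequality: Minkowski's inequality for the vectors [(1, u i)]. *)
Lemma bracket_mean (u : nat -> R) n : (0 < n)%N ->
  bracket ((\sum_(i < n) u i) / n%:R) <= (\sum_(i < n) bracket (u i)) / n%:R.
Proof.
move=> n0; have nR : 0 < n%:R :> R by rewrite ltr0n.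
rewrite ler_pdivlMr //.
have -> : bracket ((\sum_(i < n) u i) / n%:R) * n%:R =
          Num.sqrt (n%:R ^+ 2 + (\sum_(i < n) u i) ^+ 2).
  rewrite -[X in _ * X](@ger0_norm _ (n%:R)) ?ler0n // -sqrtr_sqr -sqrtrM.
    by congr Num.sqrt; field; rewrite lt0r_neq0.
  by rewrite addr_ge0 // sqr_ge0.
elim: n {n0 nR} => [|n IH]; first by rewrite !big_ord0 expr0n addr0 sqrtr0.
rewrite !big_ord_recr /= -natr1; apply: (le_trans (sqrt_minkowski _ _ _ _)).
by rewrite expr1n lerD2r.
Qed.

Lemma bracket_mid s t : bracket ((s + t) / 2) <= (bracket s + bracket t) / 2.
Proof.
pose u (i : nat) := if i == 0%N then s else t.
by have := @bracket_mean u 2 isT; rewrite !big_ord_recl !big_ord0 !addr0.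
Qed.

(** Quantitative strict convexity of [bracket] on [[-r, r]]. *)
Lemma bracket_gap s t r : 0 <= r -> `|s| <= r -> `|t| <= r ->
  (s - t) ^+ 2 <=
  4 * (1 + r) ^+ 3 * (bracket s + bracket t - 2 * bracket ((s + t) / 2)).
Proof.
move=> r0 sr tr.
have ha := bracket_ge1 s; have hb := bracket_ge1 t.
have hm := bracket_ge1 ((s + t) / 2).
have sa := bracket_sqr s; have sb := bracket_sqr t.
have sm := bracket_sqr ((s + t) / 2).
have ab := bracket_mid s t.
have aB : bracket s <= 1 + r by apply: (le_trans (bracket_le s)); lra.
have bB : bracket t <= 1 + r by apply: (le_trans (bracket_le t)); lra.
move: (bracket s) (bracket t) (bracket ((s + t) / 2)) ha hb hm sa sb sm ab aB bB.
move=> a b m ha hb hm sa sb sm ab aB bB.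
set B := 1 + r in aB bB *; set g := a + b - 2 * m.
have g0 : 0 <= g by rewrite /g; lra.
have B1 : 1 <= B by rewrite /B; lra.
have abB : a * b <= B ^+ 2 by rewrite expr2; nra.
have /ler_normlP[cs' cs] : `|1 + s * t| <= a * b.
  rewrite -(ler_pXn2r (n := 2)) ?nnegrE ?mulr_ge0 //; try lra.
  rewrite real_normK ?num_real // exprMn sa sb.
  have := sqr_ge0 (s - t); nra.
have cs0 : 0 <= a * b - (1 + s * t) by lra.
(* Lagrange's identity for the vectors [(1, s)] and [(1, t)], whose squared norms
   are [a ^+ 2] and [b ^+ 2] *)
have e1 : (s - t) ^+ 2 = (a * b - (1 + s * t)) * (a * b + (1 + s * t)).
  have -> : (a * b - (1 + s * t)) * (a * b + (1 + s * t)) =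
    a ^+ 2 * b ^+ 2 - (1 + s * t) ^+ 2 by ring.
  by rewrite sa sb; ring.
have e2 : 2 * (a * b - (1 + s * t)) = g * (a + b + 2 * m).
  rewrite /g; have -> : (a + b - 2 * m) * (a + b + 2 * m) =
    a ^+ 2 + b ^+ 2 + 2 * (a * b) - 4 * m ^+ 2 by ring.
  by rewrite sa sb sm; field.
have h1 : a * b - (1 + s * t) <= g * (2 * B).
  have : g * (a + b + 2 * m) <= g * (4 * B) by apply: ler_wpM2l => //; lra.
  by rewrite -e2; lra.
rewrite e1; apply: (@le_trans _ _ (g * (2 * B) * (2 * B ^+ 2))); last first.
  by rewrite le_eqVlt; apply/orP; left; apply/eqP; ring.
by apply: ler_pM => //; lra.
Qed.

Lemma measurable_bracket : measurable_fun [set: R] bracket.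
Proof.
apply: (measurableT_comp (continuous_measurable_fun (@sqrt_continuous R))) => //.
by apply: measurable_funD => //; exact: measurable_funX.
Qed.

Lemma measurable_fun_bracket (dT : measure_display) (T : measurableType dT)
    (f : T -> R) : measurable_fun [set: T] f ->
  measurable_fun [set: T] (fun x => bracket (f x)).
Proof. by move=> mf; exact: (measurableT_comp measurable_bracket mf). Qed.

End japanese_bracket.

(** * Averages of a stationary sequence *)

Section averages.
Context (R : realType) (dO : measure_display) (Omega : measurableType dO)
  (P : probability Omega R) (h : nat -> nat -> Omega -> R) (C : R).

Local Notation E f := (\int[P]_w (f w)%:E)%E.
Local Notation mfun f := (measurable_fun [set: Omega] f).

Hypothesis mh : forall a j, mfun (h a j).
Hypothesis hC : forall a j, (E (fun w => `|h a j w|) <= C%:E)%E.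

(** The average of [h a j] over [z <= j < z + n]. *)
Definition avg (a z n : nat) (w : Omega) : R :=
  (\sum_(j < n) h a (z + j) w) / n%:R.

(** The mean of [bracket] at the midpoint of two averages started at [z]. *)
Definition energy (a z n m : nat) : \bar R :=
  E (fun w => bracket ((avg a z n w + avg a z m w) / 2)).

(* The only consequence of stationarity that is needed. *)
Hypothesis hstat : forall a z n m, energy a z n m = energy 0 0 n m.

Lemma measurable_avg a z n : mfun (avg a z n).
Proof.
apply: measurable_funM => //.
by apply: measurable_sum => i; exact: mh.
Qed.
Hint Resolve measurable_avg : core.

Lemma bound_ge0 : 0 <= C.
Proof.
rewrite -lee_fin; apply: le_trans (hC 0 0).
by apply: integral_ge0 => w _; rewrite lee_fin.
Qed.

Lemma expect_avg a z n : (E (fun w => `|avg a z n w|) <= C%:E)%E.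
Proof.
case: n => [|n].
  under eq_integral do rewrite /avg big_ord0 mul0r normr0.
  by rewrite integral0 lee_fin bound_ge0.
apply: (@le_trans _ _
  (E (fun w => n.+1%:R^-1 * \sum_(j < n.+1) `|h a (z + j) w|)%R)).
  apply: expect_le => //.
  - exact: measurableT_comp.
  - apply: measurable_funM => //; apply: measurable_sum => i.
    exact: measurableT_comp.
  - move=> w; rewrite /avg normrM mulrC (@ger0_norm _ n.+1%:R^-1) //.
    by rewrite ler_wpM2l // ler_norm_sum.
rewrite expectZ //; last 2 first.
- by apply: measurable_sum => i; exact: measurableT_comp.
- by move=> w; exact: sumr_ge0.
rewrite (expect_sum P (f := fun j w => `|h a (z + j) w|)) //; last first.
  by move=> i; exact: measurableT_comp.
apply: (@le_trans _ _ (n.+1%:R^-1%:E * \sum_(j < n.+1) C%:E)%E).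
  by rewrite lee_pmul2l // ?lte_fin //; apply: lee_sum => i _; exact: hC.
rewrite sumEFin sumr_const card_ord -EFinM lee_fin -[C *+ _]mulr_natl.
by rewrite mulKf // pnatr_eq0.
Qed.

Lemma measurable_energy a z n m :
  mfun (fun w => bracket ((avg a z n w + avg a z m w) / 2)).
Proof.
apply: measurable_fun_bracket.
by apply: measurable_funM => //; exact: measurable_funD.
Qed.
Hint Resolve measurable_energy : core.

Lemma energy_le a z n m : (energy a z n m <= (1 + C)%:E)%E.
Proof.
apply: (@le_trans _ _ (E (fun w => 1 + (2^-1 * `|avg a z n w| +
    2^-1 * `|avg a z m w|))%R))%E.
  apply: expect_le => //.
  - apply: measurable_funD => //; apply: measurable_funD;
      by apply: measurable_funM => //; exact: measurableT_comp.
  - by move=> w; exact: bracket_ge0.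
  - move=> w; apply: (le_trans (bracket_le _)); rewrite lerD2l.
    rewrite -mulrDr mulrC normrM ger0_norm // ler_wpM2l //.
    exact: ler_normD.
have mn k : mfun (fun w => 2^-1 * `|avg a z k w|).
  by apply: measurable_funM => //; exact: measurableT_comp.
have n0 k w : 0 <= 2^-1 * `|avg a z k w| by rewrite mulr_ge0.
have ms : mfun (fun w => 2^-1 * `|avg a z n w| + 2^-1 * `|avg a z m w|).
  exact: measurable_funD.
have s0 w : 0 <= 2^-1 * `|avg a z n w| + 2^-1 * `|avg a z m w|.
  exact: addr_ge0.
rewrite (expectD P (measurable_cst (1 : R)) ms) //.
rewrite expect_cst EFinD leeD2lE // expectD //.
rewrite !expectZ //; last 2 first.
- exact: measurableT_comp.
- exact: measurableT_comp.
have -> : C%:E = (2^-1%:E * C%:E + 2^-1%:E * C%:E)%E.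
  by rewrite -EFinM -EFinD; congr EFin; field.
by apply: leeD; rewrite lee_pmul2l // ?lte_fin ?expect_avg.
Qed.

(** The finite value of [energy 0 0 n m]. *)
Definition renergy n m : R := fine (energy 0 0 n m).

Lemma renergyE n m : energy 0 0 n m = (renergy n m)%:E.
Proof.
rewrite fineK // ge0_fin_numE; first exact: le_lt_trans (energy_le _ _ _ _) (ltry _).
by apply: integral_ge0 => w _; rewrite lee_fin bracket_ge0.
Qed.

(** An average of length [N] is close to the mean of the averages of length [n]
    started at its points: each shift by [i < n] only changes terms at the two
    ends. *)
Lemma avg_shift n N w : (0 < n)%N -> (0 < N)%N ->
  `|avg 0 0 N w - (\sum_(k < N) avg 0 k n w) / N%:R| <=
  N%:R^-1 * \sum_(j < n) (`|h 0 j w| + `|h 0 (N + j) w|).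
Proof.
move=> n0 N0.
have nR : 0 < n%:R :> R by rewrite ltr0n.
have NR : 0 < N%:R :> R by rewrite ltr0n.
have -> : avg 0 0 N w - (\sum_(k < N) avg 0 k n w) / N%:R =
  N%:R^-1 * (n%:R^-1 *
    \sum_(i < n) (\sum_(j < N) h 0 j w - \sum_(j < N) h 0 (i + j) w)).
  rewrite sumrB mulrBr sumr_const card_ord -[(\sum_(_ < N) _) *+ n]mulr_natl mulKf ?lt0r_neq0 //.
  rewrite mulrBr /avg mulrC; congr (_ * _ - _).
  rewrite mulrC; congr (_ * _); rewrite -mulr_suml mulrC; congr (_ * _).
  rewrite exchange_big /=; apply: eq_bigr => i _; apply: eq_bigr => j _.
  by rewrite addnC.
rewrite normrM (ger0_norm (_ : 0 <= N%:R^-1)) ?invr_ge0 // ler_wpM2l ?invr_ge0 //.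
set S := leRHS.
rewrite normrM (ger0_norm (_ : 0 <= n%:R^-1)) ?invr_ge0 //.
rewrite mulrC ler_pdivrMr // mulr_natr.
apply: (le_trans (ler_norm_sum _ _ _)).
rewrite -[X in _ *+ X](card_ord n) -sumr_const; apply: ler_sum => i _.
have key : \sum_(j < N) h 0 j w + \sum_(j < i) h 0 (N + j) w =
    \sum_(j < i) h 0 j w + \sum_(j < N) h 0 (i + j) w.
  transitivity (\sum_(j < N + i) h 0 j w); first by rewrite big_split_ord.
  by rewrite addnC big_split_ord.
have -> : \sum_(j < N) h 0 j w - \sum_(j < N) h 0 (i + j) w =
    \sum_(j < i) (h 0 j w - h 0 (N + j) w).
  rewrite sumrB; lra.
apply: (le_trans (ler_norm_sum _ _ _)).
rewrite /S {key}; move: (nat_of_ord i) (ltnW (ltn_ord i)) => k kn.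
rewrite -(subnKC kn) big_split_ord /=.
rewrite -[leLHS]addr0; apply: lerD.
  by apply: ler_sum => j _; exact: ler_normB.
by apply: sumr_ge0 => j _; exact: addr_ge0.
Qed.

Lemma expect_shift n N : (0 < N)%N ->
  (E (fun w => N%:R^-1 * \sum_(j < n) (`|h 0 j w| + `|h 0 (N + j) w|))%R
   <= (2 * C * n%:R / N%:R)%:E)%E.
Proof.
move=> N0.
have mn a j : mfun (fun w => `|h a j w|) by exact: measurableT_comp.
have m2 j : mfun (fun w => `|h 0 j w| + `|h 0 (N + j) w|).
  exact: measurable_funD.
rewrite expectZ //; last 2 first.
- exact: measurable_sum.
- by move=> w; apply: sumr_ge0 => j _; exact: addr_ge0.
rewrite (expect_sum P (f := fun j w => `|h 0 j w| + `|h 0 (N + j) w|)) //.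
apply: (@le_trans _ _ (N%:R^-1%:E * \sum_(j < n) (C + C)%:E)%E).
  rewrite lee_pmul2l // ?lte_fin ?invr_gt0 ?ltr0n //; apply: lee_sum => j _.
  by rewrite expectD // EFinD; apply: leeD; exact: hC.
rewrite sumEFin sumr_const card_ord -EFinM lee_fin -[(C + C) *+ n]mulr_natl.
by rewrite le_eqVlt; apply/orP; left; apply/eqP; ring.
Qed.

(** The average of length [N] is close to a mean of [N] translates of the midpoint
    of averages of lengths [n] and [m], which all have the same energy. *)
Lemma energy_comparison n m N : (0 < n)%N -> (0 < m)%N -> (0 < N)%N ->
  (energy 0 0 N N <= energy 0 0 n m + (C * (n + m)%:R / N%:R)%:E)%E.
Proof.
move=> n0 m0 N0; have NR : 0 < N%:R :> R by rewrite ltr0n.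
pose G k w := (avg 0 k n w + avg 0 k m w) / 2.
pose D n w : R := N%:R^-1 * \sum_(j < n) (`|h 0 j w| + `|h 0 (N + j) w|).
have mD n' : mfun (D n').
  apply: measurable_funM => //; apply: measurable_sum => j.
  by apply: measurable_funD; exact: measurableT_comp.
have D0 n' w : 0 <= D n' w.
  by rewrite mulr_ge0 ?invr_ge0 //; apply: sumr_ge0 => j _; exact: addr_ge0.
have mG : mfun (fun w => N%:R^-1 * \sum_(k < N) bracket (G k w)).
  apply: measurable_funM => //; apply: measurable_sum => k.
  exact: measurable_energy.
have G0 w : 0 <= N%:R^-1 * \sum_(k < N) bracket (G k w).
  rewrite mulr_ge0 ?invr_ge0 //; apply: sumr_ge0 => k _; exact: bracket_ge0.
have mDD : mfun (fun w => 2^-1 * (D n w + D m w)).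
  by apply: measurable_funM => //; exact: measurable_funD.
have DD0 w : 0 <= 2^-1 * (D n w + D m w).
  by rewrite mulr_ge0 // addr_ge0.
apply: (@le_trans _ _ (E (fun w => N%:R^-1 * \sum_(k < N) bracket (G k w) +
   2^-1 * (D n w + D m w))%R)).
  apply: expect_le => //.
  - exact: measurable_funD.
  - by move=> w; exact: bracket_ge0.
  move=> w; rewrite (_ : (_ + _) / 2 = avg 0 0 N w); last by field.
  apply: (le_trans (bracket_lip _ ((\sum_(k < N) G k w) / N%:R))).
  apply: lerD; first by rewrite [leRHS]mulrC; exact: (bracket_mean (G ^~ w)).
  have -> : avg 0 0 N w - (\sum_(k < N) G k w) / N%:R =
    2^-1 * ((avg 0 0 N w - (\sum_(k < N) avg 0 k n w) / N%:R) +
            (avg 0 0 N w - (\sum_(k < N) avg 0 k m w) / N%:R)).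
    by rewrite /G -mulr_suml big_split /=; field; rewrite lt0r_neq0.
  rewrite normrM ger0_norm // ler_wpM2l //.
  by apply: (le_trans (ler_normD _ _)); apply: lerD; exact: avg_shift.
rewrite expectD //; apply: leeD.
  rewrite expectZ //; last 2 first.
  - by apply: measurable_sum => k; exact: measurable_energy.
  - by move=> w; apply: sumr_ge0 => k _; exact: bracket_ge0.
  rewrite (expect_sum P (f := fun k w => bracket (G k w))); last 2 first.
  - by move=> k; exact: measurable_energy.
  - by move=> k w; exact: bracket_ge0.
  rewrite (eq_bigr (fun=> (renergy n m)%:E)); last first.
    by move=> k _; rewrite -renergyE; exact: hstat.
  rewrite renergyE sumEFin sumr_const card_ord -EFinM lee_fin -[renergy n m *+ N]mulr_natl.
  by rewrite mulKf // lt0r_neq0.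
rewrite expectZ //; last 2 first.
- exact: measurable_funD.
- by move=> w; rewrite addr_ge0.
rewrite expectD //.
have -> : (C * (n + m)%:R / N%:R)%:E =
    (2^-1%:E * ((2 * C * n%:R / N%:R)%:E + (2 * C * m%:R / N%:R)%:E))%E.
  rewrite -EFinD -EFinM; congr EFin; rewrite natrD; field.
  by rewrite lt0r_neq0.
by rewrite lee_pmul2l // ?lte_fin //; apply: leeD; exact: expect_shift.
Qed.

(** The energies of the averages tend to their infimum, and the energy of the
    midpoint of two averages stays above it. *)
Lemma energy_gap_small e : 0 < e -> exists N0, forall n m, (N0 < n)%N ->
  (N0 < m)%N -> renergy n n + renergy m m <= 2 * renergy n m + e.
Proof.
move=> e0.
have cmp n m N : (0 < n)%N -> (0 < m)%N -> (0 < N)%N ->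
    renergy N N <= renergy n m + C * (n + m)%:R / N%:R.
  move=> n0 m0 N0; have := energy_comparison n0 m0 N0.
  by rewrite !renergyE -EFinD lee_fin.
pose T := [set renergy n n | n in [set n | (0 < n)%N]].
have T0 : has_inf T.
  split; first by exists (renergy 1 1), 1%N.
  exists 0 => _ [n _ <-]; apply: fine_ge0.
  by apply: integral_ge0 => w _; rewrite lee_fin bracket_ge0.
have small n m f : 0 < f ->
    exists2 N, (0 < N)%N & forall N', (N <= N')%N -> C * (n + m)%:R / N'%:R <= f.
  move=> f0; exists (Num.bound (C * (n + m)%:R / f)).+1 => // N' NN'.
  have N'0 : 0 < N'%:R :> R by rewrite ltr0n (leq_trans _ NN').
  rewrite ler_pdivrMr // [leRHS]mulrC -ler_pdivrMr //.
  have b0 : 0 <= C * (n + m)%:R / f by rewrite divr_ge0 ?mulr_ge0 ?bound_ge0 // ltW.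
  apply: ltW; apply: (lt_le_trans (archi_boundP b0)).
  by rewrite ler_nat ltnW.
have mid n m : (0 < n)%N -> (0 < m)%N -> inf T <= renergy n m.
  move=> n0 m0; apply/ler_addgt0Pr => f f0.
  have [N N0 /(_ N (leqnn _)) hN] := small n m f f0.
  apply: (@le_trans _ _ (renergy N N)).
    by apply: ge_inf; [exact: T0.2|exists N].
  by apply: (le_trans (cmp n m N n0 m0 N0)); rewrite lerD2l.
have e4 : 0 < e / 4 by rewrite divr_gt0.
have [_ [n0 n00 <-] hn0] := inf_adherent e4 T0.
have [N N0 hN] := small n0 n0 _ e4.
exists N => n m Nn Nm.
have hi k : (N < k)%N -> renergy k k <= inf T + e / 2.
  move=> Nk; apply: (le_trans (cmp n0 n0 k n00 n00 (leq_ltn_trans _ Nk))) => //.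
  by have := hN k (ltnW Nk); lra.
have := hi n Nn; have := hi m Nm.
have := mid n m (leq_ltn_trans (leq0n _) Nn) (leq_ltn_trans (leq0n _) Nm).
lra.
Qed.

(** The mean ergodic theorem in probability: the averages along a line form a
    Cauchy sequence in probability, uniformly in the line [a]. *)
Lemma avg_cauchy eta e : 0 < eta -> 0 < e -> exists N0, forall a n m,
  (N0 < n)%N -> (N0 < m)%N ->
  (P [set w | (eta <= `|avg a 0 n w - avg a 0 m w|)%R] <= e%:E)%E.
Proof.
move=> eta0 e0.
(* the averages exceed [r] with probability at most [e / 3] *)
pose r := 3 * (C + 1) / e.
have C0 := bound_ge0.
have r0 : 0 < r by rewrite divr_gt0 // mulr_gt0 //; lra.
pose K := 4 * (1 + r) ^+ 3.
have K0 : 0 < K by rewrite mulr_gt0 // exprn_gt0 //; lra.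
pose kappa := eta ^+ 2 / K.
have kappa0 : 0 < kappa by rewrite divr_gt0 // exprn_gt0.
have e30 : 0 < kappa * (e / 3) by rewrite mulr_gt0 // divr_gt0.
have [N0 hN0] := energy_gap_small e30.
exists N0 => a n m hn hm.
pose s w := avg a 0 n w; pose t w := avg a 0 m w.
pose g w := bracket (s w) + bracket (t w) - 2 * bracket ((s w + t w) / 2).
have mb (u : Omega -> R) : mfun u -> mfun (fun w => bracket (u w)).
  exact: measurable_fun_bracket.
have ms : mfun s by exact: measurable_avg.
have mt : mfun t by exact: measurable_avg.
have mm : mfun (fun w => 2 * bracket ((s w + t w) / 2)).
  by apply: measurable_funM => //; exact: measurable_energy.
have mg : mfun g.
  by apply: measurable_funB => //; apply: measurable_funD; exact: mb.
have g0 w : 0 <= g w by rewrite /g; have := bracket_mid (s w) (t w); lra.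
have nn (u : Omega -> R) : mfun u -> mfun (fun w => `|u w|).
  by move=> mu; exact: measurableT_comp.
have Eg : (E g <= (kappa * (e / 3))%:E)%E.
  have h1 : (E (fun w => g w + 2 * bracket ((s w + t w) / 2))%R =
            (renergy n n + renergy m m)%:E)%E.
    transitivity (E (fun w => bracket (s w) + bracket (t w))%R).
      by apply: eq_integral => w _; rewrite /g subrK.
    rewrite expectD //; last 4 first.
    - exact: mb.
    - exact: mb.
    - by move=> w; exact: bracket_ge0.
    - by move=> w; exact: bracket_ge0.
    rewrite EFinD -!renergyE -(hstat a 0 n n) -(hstat a 0 m m) /energy.
    congr (_ + _)%E; apply: eq_integral => w _; congr (bracket _)%:E;
      by rewrite /s /t; field.
  have h2 : (E (fun w => 2 * bracket ((s w + t w) / 2))%R =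
            (2 * renergy n m)%:E)%E.
    rewrite expectZ //; last 2 first.
    - exact: measurable_energy.
    - by move=> w; exact: bracket_ge0.
    by rewrite EFinM -renergyE -(hstat a 0 n m).
  rewrite expectD // in h1; last first.
    by move=> w; rewrite mulr_ge0 // bracket_ge0.
  rewrite h2 in h1.
  have := hN0 n m hn hm; move: h1.
  case: (E g) => [x| |] //; rewrite -EFinD => -[] h1 h3; rewrite lee_fin; lra.
have big (u : Omega -> R) : mfun u -> (E (fun w => `|u w|) <= C%:E)%E ->
    (P [set w | (r <= `|u w|)%R] <= (e / 3)%:E)%E.
  move=> mu uC; apply: prob_ge_le => //; first exact: nn.
  apply: (le_trans uC); rewrite lee_fin /r.
  by rewrite (_ : _ * _ = C + 1); [lra | field; rewrite lt0r_neq0].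
have b1 := big s ms (expect_avg _ _ _).
have b2 := big t mt (expect_avg _ _ _).
have b3 : (P [set w | (kappa <= g w)%R] <= (e / 3)%:E)%E by exact: prob_ge_le.
have mS1 : measurable [set w | r <= `|s w|] by apply: measurable_ge; exact: nn.
have mS2 : measurable [set w | r <= `|t w|] by apply: measurable_ge; exact: nn.
have mS3 : measurable [set w | kappa <= g w] by apply: measurable_ge.
apply: (@le_trans _ _ (P (([set w | r <= `|s w|] `|` [set w | r <= `|t w|])
                          `|` [set w | kappa <= g w]))).
  apply: le_measure; rewrite ?inE //.
  - by apply: measurable_ge; apply: nn; exact: measurable_funB.
  - by apply: measurableU => //; exact: measurableU.
  move=> w /= hw; case: (leP r `|s w|) => hs; first by left; left.
  case: (leP r `|t w|) => ht; first by left; right.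
  right; have := bracket_gap (ltW r0) (ltW hs) (ltW ht).
  rewrite -/(g w) -/K /kappa => hg; rewrite ler_pdivrMr // mulrC.
  apply: le_trans hg; rewrite -(real_normK (num_real (s w - t w))).
  by rewrite ler_pXn2r // nnegrE // ltW.
apply: (le_trans (measureU2 _ _ _)) => //; first exact: measurableU.
apply: (le_trans (leeD (measureU2 _ _ _) (le_refl _))) => //.
have -> : e%:E = ((e / 3)%:E + (e / 3)%:E + (e / 3)%:E)%E.
  by rewrite -!EFinD; congr EFin; field.
by apply: leeD => //; exact: leeD.
Qed.

End averages.

(** * Stationary flows in the plane *)

Section balanced_flow.
Context (R : realType) (dO : measure_display) (Omega : measurableType dO)
  (P : probability Omega R).

Local Notation E f := (\int[P]_w (f w)%:E)%E.
Local Notation mfun f := (measurable_fun [set: Omega] f).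

(** Convergence to zero in probability. *)
Definition vanishes (F : nat -> Omega -> R) := forall eta e, 0 < eta -> 0 < e ->
  exists N, forall n, (N < n)%N ->
    (P [set w | (eta <= `|F n w|)%R] <= e%:E)%E.

Lemma ae_le_prob (A B : set Omega) : measurable A -> measurable B ->
  {ae P, forall w, A w -> B w} -> (P A <= P B)%E.
Proof.
move=> mA mB [S [mS S0 sub]].
apply: (@le_trans _ _ (P (B `|` S))).
  apply: le_measure; rewrite ?inE //; first exact: measurableU.
  move=> w Aw; have [Bw|nBw] := pselect (B w); [by left|right].
  by apply: sub => /= h; exact/nBw/h.
by apply: (le_trans (measureU2 _ _ _)) => //; rewrite [X in (_ + X <= _)%E]S0 adde0.
Qed.

Lemma ae_and (A B : Omega -> Prop) : {ae P, forall w, A w} ->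
  {ae P, forall w, B w} -> {ae P, forall w, A w /\ B w}.
Proof. by apply: filterS2 => w a b; split. Qed.

Lemma measurable_norm_ge (f : Omega -> R) (c : R) : mfun f ->
  measurable [set w | c <= `|f w|].
Proof.
by move=> mf; apply: (@measurable_ge _ _ _ (fun w => `|f w|));
  exact: measurableT_comp.
Qed.

Lemma prob_split (f g k : Omega -> R) (a b : R) : mfun f -> mfun g -> mfun k ->
  {ae P, forall w, `|f w| <= `|g w| + `|k w|} ->
  (P [set w | (a + b <= `|f w|)%R] <=
   P [set w | (a <= `|g w|)%R] + P [set w | (b <= `|k w|)%R])%E.
Proof.
move=> mf mg mk fgk.
have mA : measurable [set w | a <= `|g w|] by exact: measurable_norm_ge.
have mB : measurable [set w | b <= `|k w|] by exact: measurable_norm_ge.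
apply: (@le_trans _ _ (P ([set w | a <= `|g w|] `|` [set w | b <= `|k w|]))).
  apply: ae_le_prob; [exact: measurable_norm_ge|exact: measurableU|].
  move: fgk; apply: filterS => w /= hw ab.
  case: (leP a `|g w|) => ha; [by left|right].
  by lra.
exact: measureU2.
Qed.

Lemma vanishes_ext (F G : nat -> Omega -> R) : (forall n, mfun (F n)) -> (forall n, mfun (G n)) ->
  (forall n, {ae P, forall w, F n w = G n w}) -> vanishes F -> vanishes G.
Proof.
move=> mF mG FG vF eta e eta0 e0; have [N hN] := vF eta e eta0 e0.
exists N => n Nn; apply: le_trans (hN n Nn).
apply: ae_le_prob; [exact: measurable_norm_ge..|].
by move: (FG n); apply: filterS => w /= ->.
Qed.

Lemma vanishesD (F G : nat -> Omega -> R) : (forall n, mfun (F n)) -> (forall n, mfun (G n)) ->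
  vanishes F -> vanishes G -> vanishes (fun n w => F n w + G n w).
Proof.
move=> mF mG vF vG eta e eta0 e0.
have eta2 : 0 < eta / 2 by rewrite divr_gt0.
have e2 : 0 < e / 2 by rewrite divr_gt0.
have [N hN] := vF _ _ eta2 e2; have [M hM] := vG _ _ eta2 e2.
exists (maxn N M) => n; rewrite gtn_max => /andP[Nn Mn].
rewrite [in X in P X](splitr eta).
apply: (@le_trans _ _ ((e / 2)%:E + (e / 2)%:E)%E); last first.
  by rewrite -EFinD -splitr.
apply: le_trans (leeD (hN n Nn) (hM n Mn)).
apply: prob_split => //; first exact: measurable_funD.
by apply/aeW => w; exact: ler_normD.
Qed.

Lemma vanishesN F : vanishes F -> vanishes (fun n w => - F n w).
Proof.
move=> vF eta e eta0 e0; have [N hN] := vF eta e eta0 e0.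
exists N => n Nn; rewrite (_ : [set w | _] = [set w | eta <= `|F n w|]) ?hN //.
by apply/seteqP; split => w /=; rewrite normrN.
Qed.

Lemma vanishes_bounded (F : nat -> Omega -> R) (C : R) : (forall n, mfun (F n)) -> 0 <= C ->
  (forall n, (E (fun w => `|F n w|) <= C%:E)%E) ->
  vanishes (fun n w => F n w / n%:R).
Proof.
move=> mF C0 FC eta e eta0 e0.
have b0 : 0 <= C / (eta * e) by rewrite divr_ge0 // mulr_ge0 // ltW.
exists (Num.bound (C / (eta * e))) => n hn.
have n0 : 0 < n%:R :> R by rewrite ltr0n (leq_ltn_trans _ hn).
rewrite (_ : [set w | _] = [set w | eta * n%:R <= `|F n w|]); last first.
  apply/seteqP; split => w /=;
    by rewrite normrM normfV (ger0_norm (ltW n0)) ler_pdivlMr.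
apply: prob_ge_le => //.
- exact: measurableT_comp.
- exact: mulr_gt0.
apply: (le_trans (FC n)); rewrite lee_fin.
have : C / (eta * e) <= n%:R.
  by apply: ltW; apply: (lt_trans (archi_boundP b0)); rewrite ltr_nat.
by rewrite ler_pdivrMr ?mulr_gt0 // => h; rewrite mulrAC [leRHS]mulrC.
Qed.

Section one_direction.
Variables (h : nat -> nat -> Omega -> R) (C : R).
Hypothesis mh : forall a j, mfun (h a j).
Hypothesis hC : forall a j, (E (fun w => `|h a j w|) <= C%:E)%E.
Hypothesis hstat :
  forall a z n m, energy P h a z n m = energy P h 0 0 n m.

Let mavg a n : mfun (avg h a 0 n). Proof. exact: measurable_avg. Qed.

(** If averages over long segments of the lines [0] and [n] agree in the limit for
    each fixed [n], then so do averages over segments of length [n], since these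
    are already close to the long ones. *)
Lemma line_difference :
  (forall n, vanishes (fun m w => avg h n 0 m w - avg h 0 0 m w)) ->
  vanishes (fun n w => avg h n 0 n w - avg h 0 0 n w).
Proof.
move=> lln eta e eta0 e0.
have eta3 : 0 < eta / 3 by rewrite divr_gt0.
have e3 : 0 < e / 3 by rewrite divr_gt0.
have [N hN] := avg_cauchy mh hC hstat eta3 e3.
exists N => n Nn; have [M hM] := lln n _ _ eta3 e3.
pose m := (maxn N M).+1.
have Nm : (N < m)%N by rewrite ltnS leq_maxl.
have Mm : (M < m)%N by rewrite ltnS leq_maxr.
have h1 := hN n n m Nn Nm; have h2 := hM m Mm; have h3 := hN 0 m n Nm Nn.
have mB a b k l : mfun (fun w => avg h a 0 k w - avg h b 0 l w).
  exact: measurable_funB.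
have -> : e%:E = ((e / 3)%:E + ((e / 3)%:E + (e / 3)%:E))%E.
  by rewrite -!EFinD; congr EFin; field.
have eta3E : eta = eta / 3 + (eta / 3 + eta / 3) by field.
rewrite [in X in P X]eta3E.
apply: le_trans (leeD h1 (leeD h2 h3)).
apply: le_trans; first apply: (prob_split (k := fun w =>
    (avg h n 0 m w - avg h 0 0 m w) + (avg h 0 0 m w - avg h 0 0 n w))) (mB _ _ _ _) (mB n n n m) _ _.
- by apply: measurable_funD; exact: mB.
- apply/aeW => w; apply: le_trans (ler_normD _ _).
  by rewrite le_eqVlt; apply/orP; left; apply/eqP; congr `|_|; ring.
rewrite leeD2lE; last exact: fin_num_measure (measurable_norm_ge _ (mB _ _ _ _)).
apply: prob_split => //; last by apply/aeW => w; exact: ler_normD.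
by apply: measurable_funD; exact: mB.
Qed.

End one_direction.

(** The flow through the long sides of a rectangle of fixed width [n] and length [m]
    is balanced by its divergence [D n m], which is small compared to [m], up to the
    flow through the short sides, which is bounded in mean. *)
Lemma flow_lln (h v : nat -> nat -> Omega -> R) (C : R)
    (D : nat -> nat -> Omega -> R) :
  (forall a j, mfun (h a j)) -> (forall a j, mfun (v a j)) ->
  (forall n m, mfun (D n m)) ->
  (forall a j, (E (fun w => `|v a j w|) <= C%:E)%E) ->
  (forall n m, {ae P, forall w, D n m w =
    \sum_(j < m) (h n j w - h 0 j w) + \sum_(a < n) (v a m w - v a 0 w)}) ->
  (forall n, vanishes (fun m w => D n m w / m%:R)) ->
  forall n, vanishes (fun m w => avg h n 0 m w - avg h 0 0 m w).
Proof.
move=> mh mv mD vC hD lln n.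
have C0 : 0 <= C.
  rewrite -lee_fin; apply: le_trans (vC 0 0).
  by apply: integral_ge0 => w _; rewrite lee_fin.
pose V m w := \sum_(a < n) (v a m w - v a 0 w).
have mV m : mfun (V m).
  by apply: measurable_sum => a; exact: measurable_funB.
have mDm m : mfun (fun w => D n m w / m%:R) by exact: measurable_funM.
have mVm m : mfun (fun w => V m w / m%:R) by exact: measurable_funM.
apply: (@vanishes_ext (fun m w => D n m w / m%:R + - (V m w / m%:R))).
- by move=> m; apply: measurable_funD => //; exact: measurableT_comp.
- by move=> m; apply: measurable_funB; exact: measurable_avg.
- move=> m; move: (hD n m); apply: filterS => w ->.
  by rewrite /avg sumrB -/(V m w); ring.
apply: vanishesD => //.
  by move=> m; exact: measurableT_comp.
apply: vanishesN; apply: (@vanishes_bounded _ (n%:R * (C + C))) => //.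
  by rewrite mulr_ge0 // addr_ge0.
move=> m.
have mn a k : mfun (fun w => `|v a k w|) by exact: measurableT_comp.
have mm a : mfun (fun w => `|v a m w| + `|v a 0 w|) by exact: measurable_funD.
apply: (@le_trans _ _ (E (fun w => \sum_(a < n) (`|v a m w| + `|v a 0 w|))%R)).
  apply: expect_le => //.
  - exact: measurableT_comp.
  - exact: measurable_sum.
  - move=> w; apply: (le_trans (ler_norm_sum _ _ _)); apply: ler_sum => a _.
    exact: ler_normB.
rewrite (expect_sum P (f := fun a w => `|v a m w| + `|v a 0 w|)) //.
apply: (@le_trans _ _ (\sum_(a < n) (C + C)%:E)%E).
  by apply: lee_sum => a _; rewrite expectD // EFinD; exact: leeD.
by rewrite sumEFin sumr_const card_ord lee_fin [leRHS]mulr_natl.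
Qed.

(** A stationary integrable flow cannot have a divergence whose total over the
    square [[0, n)^2] is of order [n] while its total over rectangles of fixed
    width and length [m] is small compared to [m]. *)
Lemma no_balanced_flow (h v : nat -> nat -> Omega -> R) (C : R)
    (D : nat -> nat -> Omega -> R) :
  (forall a j, mfun (h a j)) -> (forall a j, mfun (v a j)) ->
  (forall n m, mfun (D n m)) ->
  (forall a j, (E (fun w => `|h a j w|) <= C%:E)%E) ->
  (forall a j, (E (fun w => `|v a j w|) <= C%:E)%E) ->
  (forall a z n m, energy P h a z n m = energy P h 0 0 n m) ->
  (forall a z n m, energy P (fun b a => v a b) a z n m =
                   energy P (fun b a => v a b) 0 0 n m) ->
  (forall n m, {ae P, forall w, D n m w =
    \sum_(j < m) (h n j w - h 0 j w) + \sum_(a < n) (v a m w - v a 0 w)}) ->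
  (forall n, vanishes (fun m w => D n m w / m%:R)) ->
  (forall n, vanishes (fun m w => D m n w / m%:R)) ->
  (forall r, (0 < r)%N -> ((3 / 4)%:E <=
    P [set w | (r%:R <= `|D (16 * r) (16 * r) w|)%R])%E) -> False.
Proof.
move=> mh mv mD hC vC hs vs hD lln1 lln2 anti.
have L1 := flow_lln mh mv mD vC hD lln1.
have L2 : forall n, vanishes (fun m w => avg (fun b a => v a b) n 0 m w -
    avg (fun b a => v a b) 0 0 m w).
  apply: (@flow_lln (fun b a => v a b) (fun b a => h a b) C
    (fun b a => D a b)) => // n m.
  by move: (hD m n); apply: filterS => w ->; rewrite addrC.
have K1 := line_difference mh hC hs L1.
have K2 := line_difference (fun b a => mv a b) (fun b a => vC a b) vs L2.
pose F n w := avg h n 0 n w - avg h 0 0 n w.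
pose G n w := avg (fun b a => v a b) n 0 n w - avg (fun b a => v a b) 0 0 n w.
have mF n : mfun (F n) by apply: measurable_funB; exact: measurable_avg.
have mG n : mfun (G n) by apply: measurable_funB; exact: measurable_avg.
have K : vanishes (fun n w => D n n w / n%:R).
  apply: (@vanishes_ext (fun n w => F n w + G n w)); last exact: vanishesD.
  - by move=> n; exact: measurable_funD.
  - by move=> n; exact: measurable_funM.
  - move=> n; move: (hD n n); apply: filterS => w ->.
    by rewrite /F /G /avg !sumrB; ring.
have [N /(_ (16 * N.+1)%N) hN] := K 16^-1 2^-1 ltac:(lra) ltac:(lra).
have /hN : (N < 16 * N.+1)%N by lia.
rewrite (_ : [set w | _] = [set w | (N.+1%:R <=
    `|D (16 * N.+1) (16 * N.+1) w|)%R]); last first.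
  have p : 0 < (16 * N.+1)%:R :> R by rewrite ltr0n.
  apply/seteqP; split => w /=;
    rewrite normrM normfV (ger0_norm (ltW p)) ler_pdivlMr //;
    by rewrite natrM mulKf.
move=> h1; have := le_trans (anti N.+1 isT) h1; rewrite lee_fin; lra.
Qed.

End balanced_flow.

(** * The Poisson distribution *)

Section poisson_weights.
Context (R : realType).
Variable lam : R.
Hypothesis lam0 : 0 < lam.

Local Notation p := (poisson_pmf lam).

Lemma poisson_pmfE k : p k = lam ^+ k / k`!%:R * expR (- lam).
Proof. by rewrite /poisson_pmf lam0. Qed.

Lemma poisson_pmf_gt0 k : 0 < p k.
Proof.
by rewrite poisson_pmfE mulr_gt0 ?expR_gt0 // divr_gt0 ?exprn_gt0 // ltr0n fact_gt0.
Qed.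

Lemma poisson_pmfS k : k.+1%:R * p k.+1 = lam * p k.
Proof.
rewrite !poisson_pmfE factS natrM exprS; field.
by rewrite !lt0r_neq0 // ltr0n ?fact_gt0.
Qed.

Lemma poisson_prob1 k : poisson_prob lam 0 [set k] = (p k)%:E.
Proof.
by rewrite /poisson_prob lam0 esum_set1 // lee_fin ltW // poisson_pmf_gt0.
Qed.

(** The expectation of [g] under the Poisson distribution of parameter [lam]. *)
Definition poisson_mean (g : nat -> R) : \bar R :=
  (\sum_(k <oo) (g k * p k)%:E)%E.

Let term_ge0 (g : nat -> R) k : (forall i, 0 <= g i) ->
  (0 <= (g k * p k)%:E)%E.
Proof. by move=> g0; rewrite lee_fin mulr_ge0 // ltW // poisson_pmf_gt0. Qed.

Lemma poisson_mean1 : poisson_mean (fun=> 1) = 1%E.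
Proof.
have : poisson_prob lam 0 [set: nat] = 1%E by exact: probability_setT.
rewrite /poisson_prob lam0.
rewrite -nneseries_esumT; last first.
  by move=> n; rewrite lee_fin ltW // poisson_pmf_gt0.
by move=> <-; apply: eq_eseriesr => k _; rewrite mul1r.
Qed.

Lemma poisson_mean_le (f g : nat -> R) : (forall k, 0 <= f k) ->
  (forall k, f k <= g k) -> (poisson_mean f <= poisson_mean g)%E.
Proof.
move=> f0 fg; apply: lee_nneseries => k _; first by move=> _; exact: term_ge0.
by rewrite lee_fin ler_pM2r // poisson_pmf_gt0.
Qed.

Lemma poisson_meanD (f g : nat -> R) : (forall k, 0 <= f k) ->
  (forall k, 0 <= g k) ->
  (poisson_mean (fun k => f k + g k)%R = poisson_mean f + poisson_mean g)%E.
Proof.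
move=> f0 g0; rewrite /poisson_mean -nneseriesD; last 2 first.
- by move=> k _ _; exact: term_ge0.
- by move=> k _ _; exact: term_ge0.
by apply: eq_eseriesr => k _; rewrite -EFinD mulrDl.
Qed.

Lemma poisson_meanZ (c : R) (f : nat -> R) : (forall k, 0 <= f k) ->
  (poisson_mean (fun k => c * f k)%R = c%:E * poisson_mean f)%E.
Proof.
move=> f0; rewrite /poisson_mean -nneseriesZl; last first.
  by move=> k _; exact: term_ge0.
by apply: eq_eseriesr => k _; rewrite -EFinM mulrA.
Qed.

(** Stein's identity. *)
Lemma poisson_mean_shift (g : nat -> R) : (forall k, 0 <= g k) ->
  (poisson_mean (fun k => k%:R * g k.-1)%R = lam%:E * poisson_mean g)%E.
Proof.
move=> g0; rewrite -poisson_meanZ // /poisson_mean nneseries_recl //; last first.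
  by move=> k _; apply: (term_ge0 (g := fun k => k%:R * g k.-1)) => i; exact: mulr_ge0.
rewrite !mul0r add0e -nneseries_addn; last first.
  by move=> k; apply: (term_ge0 (g := fun k => k%:R * g k.-1)) => i; exact: mulr_ge0.
apply: eq_eseriesr => k _; rewrite addn1 /=; congr EFin.
by rewrite mulrAC poisson_pmfS; ring.
Qed.

(** The factorial moments of the Poisson distribution. *)
Lemma poisson_mean_ffact n :
  poisson_mean (fun k => (k ^_ n)%:R) = (lam ^+ n)%:E.
Proof.
elim: n => [|n IH].
  rewrite expr0 -poisson_mean1; apply: eq_eseriesr => k _; by rewrite ffactn0.
rewrite exprS EFinM -IH -poisson_mean_shift //.
by apply: eq_eseriesr => k _; rewrite ffactnS natrM.
Qed.

Lemma poisson_mean_id : poisson_mean (fun k => k%:R) = lam%:E.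
Proof.
by rewrite -[RHS](poisson_mean_ffact 1); apply: eq_eseriesr => k _; rewrite ffactn1.
Qed.

Lemma poisson_variance : poisson_mean (fun k => (k%:R - lam) ^+ 2) = lam%:E.
Proof.
have q0 k : 0 <= (k%:R - lam) ^+ 2 by exact: sqr_ge0.
have l0 : 0 <= 2 * lam by rewrite mulr_ge0 // ltW.
have : (poisson_mean (fun k => (k%:R - lam) ^+ 2 + (2 * lam) * k%:R)%R =
   poisson_mean (fun k => ((k ^_ 2)%:R + k%:R) + lam ^+ 2 * 1)%R)%E.
  apply: eq_eseriesr => k _; congr (_ * _)%:E.
  have -> : (k ^_ 2)%:R = k%:R * (k%:R - 1) :> R.
    by case: k => [|k]; rewrite ?mul0r // ffactnS ffactn1 natrM -natr1 addrK.
  by ring.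
have k0 k : 0 <= 2 * lam * k%:R by rewrite mulr_ge0.
have s0 k : 0 <= (k ^_ 2)%:R + k%:R :> R by rewrite addr_ge0.
have c0 (k : nat) : 0 <= lam ^+ 2 * 1 by rewrite mulr1 sqr_ge0.
rewrite !poisson_meanD //.
rewrite !poisson_meanZ // poisson_mean_ffact poisson_mean_id poisson_mean1.
case: (poisson_mean _) => [x| |] //; rewrite -!EFinM -!EFinD => -[] h.
by congr EFin; clear -h; move: h; rewrite mulr1 => h; lra.
Qed.

Lemma poisson_tail n :
  (poisson_mean (fun k => if (n <= k)%N then 1 else 0)%R <= (lam ^+ n / n`!%:R)%:E)%E.
Proof.
have f0 : 0 < n`!%:R :> R by rewrite ltr0n fact_gt0.
rewrite mulrC EFinM -poisson_mean_ffact -poisson_meanZ //.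
apply: poisson_mean_le => k; first by case: (n <= k)%N.
case: leqP => [nk|_]; last first.
  by rewrite mulr_ge0 // invr_ge0 ltW.
rewrite mulrC ler_pdivlMr // mul1r ler_nat -bin_ffact.
by rewrite leq_pmull ?bin_gt0.
Qed.

Lemma poisson_chebyshev (c : R) : 0 < c ->
  (poisson_mean (fun k => if c <= `|k%:R - lam| then 1 else 0)%R <= (lam / c ^+ 2)%:E)%E.
Proof.
move=> c0; have c20 : 0 < c ^+ 2 by rewrite exprn_gt0.
rewrite mulrC EFinM -poisson_variance -poisson_meanZ; last first.
  by move=> k; exact: sqr_ge0.
apply: poisson_mean_le => k; first by case: ifP.
case: ifP => [ck|_]; last first.
  by rewrite mulr_ge0 ?sqr_ge0 // invr_ge0 ltW.
rewrite mulrC ler_pdivlMr // mul1r -[leRHS](real_normK (num_real _)).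
by rewrite ler_pXn2r // nnegrE // ltW.
Qed.

Lemma poisson_pmf_sum n m : (m <= n.+1)%N -> \sum_(j < m) p (n - j) <= 1.
Proof.
move=> mn; have p0 k : 0 <= p k by rewrite ltW // poisson_pmf_gt0.
apply: (@le_trans _ _ (\sum_(j < n.+1) p (n - j))).
  rewrite -(subnKC mn) big_split_ord /= lerDl.
  by apply: sumr_ge0 => j _; exact: p0.
rewrite (reindex_inj rev_ord_inj) /= (eq_bigr (fun k : 'I_n.+1 => p k)); last first.
  by move=> k _; rewrite subSS subKn // -ltnS.
rewrite -lee_fin -poisson_mean1 -sumEFin.
rewrite -(big_mkord predT (fun k => (p k)%:E)).
rewrite (eq_bigr (fun k => (1 * p k)%:E)); last by move=> k _; rewrite mul1r.
by apply: nneseries_lim_ge => k _ _; exact: (@term_ge0 (fun=> 1)).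
Qed.

End poisson_weights.

Section poisson_mode.
Context (R : realType) (n : nat).
Hypothesis n0 : (0 < n)%N.
Let lam : R := n%:R.
Let lam0 : 0 < lam. Proof. by rewrite ltr0n. Qed.
Local Notation p := (poisson_pmf lam).

Lemma poisson_mode k : p k <= p n.
Proof.
have step i : i.+1%:R * p i.+1 = lam * p i by exact: poisson_pmfS.
have pos i : 0 < p i by exact: poisson_pmf_gt0.
case: (leqP k n) => [kn|/ltnW nk].
  rewrite -(subKn kn); elim: (n - k)%N => [|i IH]; first by rewrite subn0.
  apply: le_trans IH; case: (ltnP i n) => [lin|]; last first.
    by move=> h; rewrite (_ : n - i.+1 = n - i)%N //; lia.
  have := step (n - i.+1)%N; rewrite subnSK // => h.
  rewrite -(ler_pM2l lam0) -h ler_pM2r // /lam ler_nat; lia.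
rewrite -(subnKC nk); elim: (k - n)%N => [|i IH]; first by rewrite addn0.
apply: le_trans IH; rewrite addnS.
have h := step (n + i)%N.
have q : 0 < (n + i).+1%:R :> R by rewrite ltr0n.
rewrite -(ler_pM2l q) h ler_pM2r // /lam ler_nat; lia.
Qed.

(** The weights decrease slowly below the mode [n]: they stay above half of the
    largest one at distance at most [sqrt n]. *)
Lemma poisson_below_mode j : (j <= n)%N ->
  p n * (1 - (j * j.-1)%:R / (2 * lam)) <= p (n - j).
Proof.
have step i : i.+1%:R * p i.+1 = lam * p i by exact: poisson_pmfS.
have pos i : 0 < p i by exact: poisson_pmf_gt0.
elim: j => [_|j IH jn]; first by rewrite mul0n mul0r subr0 mulr1 subn0.
have {}IH := IH (ltnW jn).
have -> : p (n - j.+1) = p (n - j) * (1 - j%:R / lam).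
  have := step (n - j.+1)%N; rewrite subnSK // => h.
  apply: (mulfI (lt0r_neq0 lam0)); rewrite -h natrB ?(ltnW jn) // -/lam.
  by field; rewrite lt0r_neq0.
have jl : j%:R / lam <= 1 by rewrite ler_pdivrMr // mul1r ler_nat ltnW.
apply: (@le_trans _ _ (p n * (1 - (j * j.-1)%:R / (2 * lam)) * (1 - j%:R / lam))).
  rewrite -mulrA ler_pM2l //.
  have -> : (j.+1 * j.+1.-1)%:R / (2 * lam) =
      (j * j.-1)%:R / (2 * lam) + j%:R / lam :> R.
    have -> : (j.+1 * j.+1.-1 = j * j.-1 + 2 * j)%N by case: (j) => [|i] //=; lia.
    by rewrite natrD natrM; field; rewrite lt0r_neq0.
  have h1 : 0 <= (j * j.-1)%:R / (2 * lam).
    by rewrite divr_ge0 // mulr_ge0 // ltW.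
  have h2 : 0 <= j%:R / lam by rewrite divr_ge0 // ltW.
  have := mulr_ge0 h1 h2; lra.
by rewrite ler_wpM2r // subr_ge0.
Qed.

(** At least [m] weights are at least half of the largest one, and they add up to
    at most [1]. *)
Lemma poisson_pmf_bound m k : (m ^ 2 = n)%N -> p k <= 2 / m%:R.
Proof.
move=> mn; have m0 : (0 < m)%N by move: n0; rewrite -mn sqrn_gt0.
have mR : 0 < m%:R :> R by rewrite ltr0n.
have mn1 : (m <= n)%N by rewrite -mn; nia.
apply: (le_trans (poisson_mode k)); rewrite ler_pdivlMr //.
have half j : (j < m)%N -> p n / 2 <= p (n - j).
  move=> jm; apply: le_trans (poisson_below_mode (leq_trans (ltnW jm) mn1)).
  rewrite ler_pM2l ?poisson_pmf_gt0 //.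
  have : (j * j.-1)%:R / (2 * lam) <= 2^-1; last lra.
  rewrite ler_pdivrMr ?mulr_gt0 // mulrA mulVf // mul1r ler_nat -mn; nia.
have := poisson_pmf_sum lam0 (leqW mn1).
move=> h; have : \sum_(j < m) p n / 2 <= 1.
  by apply: le_trans h; apply: ler_sum => j _; exact: half.
by rewrite sumr_const card_ord -[_ *+ m]mulr_natr; lra.
Qed.

End poisson_mode.

Section discrete_variable.
Context (R : realType) (dO : measure_display) (Omega : measurableType dO)
  (P : probability Omega R).
Variable lam : R.
Hypothesis lam0 : 0 < lam.
Local Notation p := (poisson_pmf lam).

(** [X] has the Poisson distribution of parameter [lam]. The values of [X] are
    extended reals, as those of a measure; that they are almost surely natural
    numbers is a consequence ([poisson_integer]). *)
Definition poisson_variable (X : Omega -> \bar R) :=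
  measurable_fun [set: Omega] X /\
  forall k : nat, P [set w | X w = k%:R%:E] = (p k)%:E.

Section one.
Variable X : Omega -> \bar R.
Hypothesis hX : poisson_variable X.

Let F k := [set w | X w = k%:R%:E].

Lemma measurable_level (e : \bar R) : measurable [set w | X w = e].
Proof.
rewrite -[X in measurable X]setTI.
by apply: (hX.1 measurableT [set e]); exact: emeasurable_set1.
Qed.

Let mF k : measurable (F k). Proof. exact: measurable_level. Qed.

Let tF : trivIset [set: nat] F.
Proof.
apply/trivIsetP => i j _ _ ij; apply/seteqP; split => // w [Fi Fj].
have [/eqP] := etrans (esym Fi) Fj.
by rewrite eqr_nat (negbTE ij).
Qed.

Let PF : P (\bigcup_k F k) = 1%E.
Proof.
rewrite measure_semi_bigcup //; last exact: bigcup_measurable.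
rewrite -(poisson_mean1 lam0); apply: eq_eseriesr => k _.
by rewrite mul1r; exact: hX.2.
Qed.

Let PFC : P (~` \bigcup_k F k) = 0%E.
Proof.
by rewrite probability_setC ?PF ?subee //; exact: bigcup_measurable.
Qed.

Lemma poisson_integer : {ae P, forall w, exists k : nat, X w = k%:R%:E}.
Proof.
exists (~` \bigcup_k F k); split => //.
  by apply: measurableC; exact: bigcup_measurable.
by move=> w h [k _ Fk]; apply: h; exists k.
Qed.

(** The law of total probability. *)
Lemma poisson_total A : measurable A ->
  P A = (\sum_(k <oo) P (A `&` [set w | X w = k%:R%:E]))%E.
Proof.
move=> mA; have mAF k : measurable (A `&` F k) by exact: measurableI.
have mU : measurable (\bigcup_k F k) by exact: bigcup_measurable.
transitivity (P (A `&` \bigcup_k F k)).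
  apply/eqP; rewrite eq_le; apply/andP; split; last first.
    by apply: le_measure; rewrite ?inE //; exact: measurableI.
  rewrite -[leLHS](_ : P ((A `&` \bigcup_k F k) `|` (A `\` \bigcup_k F k)) = _);
    last by rewrite setUIDK.
  apply: (le_trans (measureU2 _ _ _)).
  - exact: measurableI.
  - exact: measurableD.
  rewrite -[leRHS]adde0 leeD2l // -PFC; apply: le_measure; rewrite ?inE.
  - exact: measurableD.
  - exact: measurableC.
  - by move=> w [].
rewrite setI_bigcupr measure_semi_bigcup //; last exact: bigcup_measurable.
apply/trivIsetP => i j _ _ ij; rewrite setIACA setIid.
by move/trivIsetP : tF => /(_ _ _ Logic.I Logic.I ij) ->; rewrite setI0.
Qed.

Lemma poisson_event (B : set \bar R) : measurable B ->
  P (X @^-1` B) = poisson_mean lam (fun k => \1_B (k%:R%:E)).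
Proof.
move=> mB; have mXB : measurable (X @^-1` B).
  by rewrite -[X in measurable X]setTI; exact: hX.1.
rewrite poisson_total //; apply: eq_eseriesr => k _.
rewrite indicE; case: (boolP (_ \in B)); rewrite ?inE ?notin_setE => Bk.
  rewrite mul1r -hX.2; congr (P _); apply/seteqP; split => w /=; first by case.
  by move=> Xw; split => //; rewrite Xw.
rewrite mul0r (_ : _ `&` _ = set0) ?measure0 //.
by apply/seteqP; split => w //= -[Bw Xw]; apply: Bk; rewrite /= -Xw.
Qed.

Lemma poisson_expect : (forall w, 0 <= X w)%E -> (\int[P]_w X w = lam%:E)%E.
Proof.
move=> X0; rewrite (@ge0_negligible_integral _ _ _ P _ (~` \bigcup_k F k)) //;
  last 2 first.
- by apply: measurableC; exact: bigcup_measurable.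
- exact: hX.1.
rewrite setTD setCK ge0_integral_bigcup //; last first.
  by apply: measurable_funTS; exact: hX.1.
rewrite -(poisson_mean_id lam0); apply: eq_eseriesr => k _.
rewrite (eq_integral (fun=> k%:R%:E)); last by move=> w; rewrite inE.
by rewrite integral_cst // EFinM; congr (_ * _)%E; exact: hX.2.
Qed.

End one.
End discrete_variable.

(** * Differences of independent Poisson variables *)

Section poisson_difference.
Context (R : realType) (dO : measure_display) (Omega : measurableType dO)
  (P : probability Omega R).

(** Independence of two extended random variables. *)
Definition independent_pair (X Y : Omega -> \bar R) :=
  forall A B : set (\bar R), measurable A -> measurable B ->
    P (X @^-1` A `&` Y @^-1` B) = (P (X @^-1` A) * P (Y @^-1` B))%E.

Lemma independent_pairC X Y : independent_pair X Y -> independent_pair Y X.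
Proof. by move=> XY A B mA mB; rewrite setIC XY // muleC. Qed.

Lemma poisson_variable_law lam (X Y : Omega -> \bar R) (B : set (\bar R)) :
  0 < lam -> poisson_variable P lam X -> poisson_variable P lam Y ->
  measurable B -> P (X @^-1` B) = P (Y @^-1` B).
Proof. by move=> l0 hX hY mB; rewrite !(poisson_event l0). Qed.

Lemma measurable_fine_ge (f : R -> R) (c : R) : measurable_fun [set: R] f ->
  measurable [set y : \bar R | c <= f (fine y)].
Proof.
move=> mf; apply: (@measurable_ge _ _ _ (fun y : \bar R => f (fine y)) c).
by apply: (measurableT_comp mf); exact: fine_measurable.
Qed.

Section conditioning.
Variables (X Y : Omega -> \bar R) (lam : R).
Hypothesis lam0 : 0 < lam.
Hypothesis hX : poisson_variable P lam X.
Hypothesis XY : independent_pair X Y.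

(** An event that amounts to [B k (Y w)] when [X w = k] is computed by conditioning
    on the value of [X]. *)
Lemma condition_on (S : set Omega) (B : nat -> set (\bar R)) : measurable S ->
  (forall k, measurable (B k)) ->
  (forall k w, X w = k%:R%:E -> (S w <-> B k (Y w))) ->
  P S = (\sum_(k <oo) (poisson_pmf lam k)%:E * P (Y @^-1` B k))%E.
Proof.
move=> mS mB SB; rewrite (poisson_total lam0 hX) //.
apply: eq_eseriesr => k _; rewrite -hX.2.
transitivity (P (X @^-1` [set k%:R%:E] `&` Y @^-1` B k)).
  by congr (P _); apply/seteqP; split => w /= -[] a b; split => //; exact/(SB k w).
by rewrite XY //; exact: emeasurable_set1.
Qed.

End conditioning.

Variables (X Y : Omega -> \bar R).
Variables r : nat.
Hypothesis r0 : (0 < r)%N.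
Let m := (16 * r)%N.
Let lam : R := (m ^ 2)%:R.
Let m0 : (0 < m ^ 2)%N. Proof. by rewrite sqrn_gt0 muln_gt0. Qed.
Let lam0 : 0 < lam. Proof. by rewrite ltr0n. Qed.
Hypothesis hX : poisson_variable P lam X.
Hypothesis hY : poisson_variable P lam Y.
Hypothesis XY : independent_pair X Y.

Let mfX : measurable_fun [set: Omega] (fun w => fine (X w)).
Proof. by apply: (measurableT_comp _ hX.1); exact: fine_measurable. Qed.
Let mfY : measurable_fun [set: Omega] (fun w => fine (Y w)).
Proof. by apply: (measurableT_comp _ hY.1); exact: fine_measurable. Qed.
Let mXY : measurable_fun [set: Omega] (fun w => fine (X w) - fine (Y w)).
Proof. exact: measurable_funB. Qed.

Let near k := [set y : \bar R | `|k%:R - fine y| < r%:R].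

Let measurable_near k : measurable (near k).
Proof.
rewrite (_ : near k = ~` [set y | r%:R <= `|k%:R - fine y|]); last first.
  by apply/seteqP; split => y; rewrite /near /= ltNge => /negP.
apply: measurableC.
apply: (@measurable_fine_ge (fun y => `|k%:R - y|)).
by apply: measurableT_comp => //; exact: measurable_funB.
Qed.

(** An interval of [2 r - 1] integers has Poisson probability at most
    [2 r * (2 / (16 r))]. *)
Lemma near_small k : (P (Y @^-1` near k) <= (4^-1)%:E)%E.
Proof.
pose F i := [set w | Y w = (k.+1 + i - r)%:R%:E].
have mF i : measurable (F i) by exact: (measurable_level hY).
apply: (@le_trans _ _ (P (\big[setU/set0]_(i < 2 * r) F i))).
  apply: ae_le_prob.
  - by rewrite -[X in measurable X]setTI; exact: hY.1.
  - exact: bigsetU_measurable.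
  move: (poisson_integer lam0 hY); apply: filterS => w [j Yj].
  rewrite /near /= Yj /= ltr_norml => /andP[h1 h2].
  have {}h1 : (j < k + r)%N by rewrite -(ltr_nat R) natrD; lra.
  have {}h2 : (k < j + r)%N by rewrite -(ltr_nat R) natrD; lra.
  have il : (j + r - k.+1 < 2 * r)%N by lia.
  rewrite (bigD1 (Ordinal il)) //=; left; rewrite /F /= Yj; congr (_%:R%:E); lia.
apply: (le_trans (Boole_inequality _ _)) => //.
apply: (@le_trans _ _ (\sum_(i < 2 * r) (2 / m%:R)%:E)%E).
  apply: lee_sum => i _; rewrite [leLHS]hY.2 lee_fin.
  by apply: (@poisson_pmf_bound _ (m ^ 2) m0 m).
rewrite sumEFin sumr_const card_ord lee_fin -[_ *+ (2 * r)]mulr_natr /m !natrM.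
have rR : 0 < r%:R :> R by rewrite ltr0n.
by rewrite le_eqVlt; apply/orP; left; apply/eqP; field; rewrite lt0r_neq0.
Qed.

Lemma difference_near :
  (P [set w | (`|fine (X w) - fine (Y w)| < r%:R)%R] <= (4^-1)%:E)%E.
Proof.
rewrite (@condition_on _ _ lam lam0 hX XY _ near) //; last 2 first.
- rewrite (_ : [set w | _] = ~` [set w | r%:R <= `|fine (X w) - fine (Y w)|]).
    by apply: measurableC; exact: measurable_norm_ge.
  by apply/seteqP; split => w; rewrite /= ltNge => /negP.
- by move=> k w Xk; rewrite /near /= Xk.
apply: (@le_trans _ _ (\sum_(k <oo) 4^-1%:E * (1 * poisson_pmf lam k)%:E)%E).
  apply: lee_nneseries => k _.
    by move=> _; rewrite mule_ge0 // lee_fin ltW // poisson_pmf_gt0.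
  rewrite mul1r muleC lee_wpmul2r ?near_small // lee_fin ltW //.
  exact: poisson_pmf_gt0.
rewrite nneseriesZl; last first.
  by move=> k _; rewrite lee_fin mul1r ltW // poisson_pmf_gt0.
by rewrite [X in (_ * X)%E](poisson_mean1 lam0) mule1.
Qed.

Lemma difference_large :
  ((3 / 4)%:E <= P [set w | (r%:R <= `|fine (X w) - fine (Y w)|)%R])%E.
Proof.
have mS : measurable [set w | r%:R <= `|fine (X w) - fine (Y w)|].
  exact: measurable_norm_ge.
have := difference_near; set S := [set w | r%:R <= _] in mS *.
have -> : [set w | `|fine (X w) - fine (Y w)| < r%:R] = ~` S.
  by apply/seteqP; split => w; rewrite /S /= ltNge => /negP.
rewrite probability_setC //.
have : P S \is a fin_num by exact: fin_num_measure.
by case: (P S) => // x _; rewrite (_ : 1%E - x%:E = (1 - x)%:E)%E // !lee_fin; lra.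
Qed.

(** [X - Y] and [Y - X] have the same distribution, hence half of [3 / 4]. *)
Lemma difference_positive :
  ((3 / 8)%:E <= P [set w | (r%:R <= fine (X w) - fine (Y w))%R])%E.
Proof.
pose S := [set w | r%:R <= fine (X w) - fine (Y w)].
pose S' := [set w | r%:R <= fine (Y w) - fine (X w)].
pose B k := [set y : \bar R | r%:R <= k%:R - fine y].
have mS : measurable S by exact: measurable_ge.
have mS' : measurable S' by apply: measurable_ge; exact: measurable_funB.
have mB k : measurable (B k).
  by apply: (@measurable_fine_ge (fun y => k%:R - y)); exact: measurable_funB.
have SS' : P S = P S'.
  rewrite (@condition_on _ _ lam lam0 hX XY _ B) //; last first.
    by move=> k w Xk; rewrite /S /B /= Xk.
  rewrite (@condition_on _ _ lam lam0 hY (independent_pairC XY) _ B) //; last first.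
    by move=> k w Yk; rewrite /S' /B /= Yk.
  apply: eq_eseriesr => k _; congr (_ * _)%E.
  exact: (poisson_variable_law lam0).
have := difference_large.
have : (P [set w | (r%:R <= `|fine (X w) - fine (Y w)|)%R] <= P S + P S')%E.
  apply: (le_trans _ (measureU2 P mS mS')).
  apply: le_measure; rewrite ?inE; [exact: measurable_norm_ge|exact: measurableU|].
  move=> w; rewrite /S /S' /= ler_normr => /orP[h|h]; [by left|right].
  by rewrite -opprB.
rewrite -SS' => h1 h2; have := le_trans h2 h1.
have : P S \is a fin_num by exact: fin_num_measure.
by rewrite -/S; case: (P S) => // x _; rewrite -EFinD !lee_fin; lra.
Qed.

End poisson_difference.

(** * Boxes and random measures *)

Section boxes.
Context (R : realType).

(** The box with lower corner [a] and upper corner [b], closed below and open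
    above. *)
Definition box (d : nat) (a b : 'I_d -> R) : set (d.-tuple R) :=
  [set x | forall i, a i <= tnth x i < b i].

Lemma measurable_coord (d : nat) (i : 'I_d) (I : set R) : measurable I ->
  measurable [set x : d.-tuple R | I (tnth x i)].
Proof.
move=> mI; rewrite -[X in measurable X]setTI.
exact: (@measurable_tnth _ R d i measurableT I mI).
Qed.

Lemma measurable_box (d : nat) (a b : 'I_d -> R) : measurable (box a b).
Proof.
rewrite (_ : box a b = \bigcap_(i in [set: 'I_d])
    [set x | `[a i, b i[%classic (tnth x i)]); last first.
  apply/seteqP; split => x /=; first by move=> h i _; rewrite /= in_itv /= h.
  by move=> h i; have := h i Logic.I; rewrite /= in_itv.
apply: fin_bigcap_measurable; first exact: finite_finset.
by move=> i _; apply: measurable_coord; exact: measurable_itv.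
Qed.

Lemma bounded_box (d : nat) (a b : 'I_d -> R) : bounded_region (box a b).
Proof.
exists (Num.sqrt (\sum_(i < d) (`|a i| + `|b i|) ^+ 2)) => x hx.
rewrite ler_sqrt; last by apply: sumr_ge0 => i _; exact: sqr_ge0.
apply: ler_sum => i _; have /andP[h1 h2] := hx i.
rewrite -[leLHS](real_normK (num_real _)) ler_pXn2r ?nnegrE ?addr_ge0 //.
have := ler_norm (- a i); have := ler_norm (b i); rewrite normrN.
have := normr_ge0 (a i); have := normr_ge0 (b i).
by rewrite ler_norml => *; apply/andP; split; lra.
Qed.

Lemma lebesgue_box (d : nat) (a b : 'I_d -> R) : (forall i, a i <= b i) ->
  lebesgue_tuple R d (box a b) = (\prod_(i < d) (b i - a i))%:E.
Proof.
elim: d a b => [|d IH] a b ab.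
  by rewrite big_ord0 /= diracE mem_set //= => -[].
rewrite big_ord_recl /= /tcons_measure /pushforward.
rewrite (_ : _ @^-1` _ = `[a ord0, b ord0[%classic `*`
    box (fun i => a (lift ord0 i)) (fun i => b (lift ord0 i))); last first.
  apply/seteqP; split => -[x t] /=.
    move=> h; split => /=.
      by have := h ord0; rewrite /tcons in_itv /= (tnth_nth 0).
    by move=> i; have := h (lift ord0 i); rewrite /tcons !(tnth_nth 0) /=.
  move=> [/= h0 h] i; have [->|] := eqVneq i ord0.
    by move: h0; rewrite /tcons in_itv /= (tnth_nth 0).
  case: (unliftP ord0 i) => [j ->|-> /eqP//] _.
  by have := h j; rewrite /tcons !(tnth_nth 0) /=.
rewrite product_measure1E; last 2 first.
- exact: measurable_itv.
- exact: measurable_box.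
rewrite IH; last by move=> i; exact: ab.
rewrite EFinM; congr (_ * _)%E.
transitivity (lebesgue_measure `[a ord0, b ord0[%classic) => //.
rewrite lebesgue_measure_itv /= lte_fin; case: ltP => h; first by rewrite EFinB.
by rewrite (le_anti (introT andP (conj h (ab ord0)))) subrr.
Qed.

End boxes.

Section poisson_boxes.
Context (R : realType) (dO : measure_display) (Omega : measurableType dO)
  (P : probability Omega R) (d : nat).

Lemma poisson_variable_box (N : R.-ker Omega ~> d.-tuple R) (a b : 'I_d -> R)
    (lam : R) : unit_poisson_process P N -> (forall i, a i <= b i) ->
  \prod_(i < d) (b i - a i) = lam -> 0 < lam ->
  poisson_variable P lam (fun w => N w (box a b)).
Proof.
move=> [_ hN _] ab <- l0; split; first by apply: measurable_kernel; exact: measurable_box.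
move=> k; rewrite hN ?lebesgue_box //=; [exact: poisson_prob1|exact: measurable_box|].
exact: bounded_box.
Qed.

End poisson_boxes.

Section law_of_random_measures.
Context (R : realType) (dO : measure_display) (Omega : measurableType dO)
  (P : probability Omega R) (dT : measure_display) (T : measurableType dT).

(** The space of measures on [T], with the sigma-algebra [config_event]. *)
Definition config : Type := {measure set T -> \bar R}.

HB.instance Definition _ := gen_eqMixin config.
HB.instance Definition _ := gen_choiceMixin config.
HB.instance Definition _ := isPointed.Build config (mzero : {measure set T -> \bar R}).

Let generators : set (set config) := \bigcup_(A in @measurable dT T)
  preimage_set_system [set: {measure set T -> \bar R}]
    (fun mu : {measure set T -> \bar R} => mu A) (@measurable _ (\bar R)).

Let configC (A : set config) : config_event A -> config_event (~` A).
Proof. by move=> mA; rewrite -setTD; exact: sigma_algebraCD. Qed.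

HB.instance Definition _ := @isMeasurable.Build (sigma_display generators) config
  (@config_event R dT T) (@sigma_algebra0 _ setT generators) configC
  (@sigma_algebra_bigcup _ setT generators).

Lemma measurable_eval (A : set T) : measurable A ->
  measurable_fun [set: config]
    (fun mu : config => (mu : {measure set T -> \bar R}) A).
Proof.
move=> mA _ Y mY; apply: sub_sigma_algebra; exists A => //.
by exists Y.
Qed.

Lemma measurable_random_measure (N : Omega -> {measure set T -> \bar R}) :
  (forall A, measurable A -> measurable_fun [set: Omega] (fun w => N w A)) ->
  measurable_fun [set: Omega] (N : Omega -> config).
Proof.
move=> mN; apply: (@measurability _ _ _ config _ _ generators) => //.
move=> _ [_ [A mA [Y mY <-]] <-].
by rewrite !setTI; have := mN A mA measurableT Y mY; rewrite setTI.
Qed.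

(** Random measures of the same law give the same expectation to every nonnegative
    measurable functional. *)
Lemma same_law_integral (N N' : Omega -> {measure set T -> \bar R})
    (F : config -> \bar R) :
  (forall A, measurable A -> measurable_fun [set: Omega] (fun w => N w A)) ->
  (forall A, measurable A -> measurable_fun [set: Omega] (fun w => N' w A)) ->
  same_law P N N' -> measurable_fun [set: config] F ->
  (forall mu, 0 <= F mu)%E ->
  (\int[P]_w F (N w) = \int[P]_w F (N' w))%E.
Proof.
move=> /measurable_random_measure mN /measurable_random_measure mN' NN' mF F0.
transitivity (\int[pushforward P (N : Omega -> config)]_mu F mu)%E.
  by rewrite ge0_integral_pushforward // => mu _; exact: F0.
transitivity (\int[pushforward P (N' : Omega -> config)]_mu F mu)%E; last first.
  by rewrite ge0_integral_pushforward // => mu _; exact: F0.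
apply: eq_measure_integral => C mC _; exact: NN'.
Qed.

End law_of_random_measures.

(** * Matchings *)

Section counting.
Context (R : realType).

Lemma count_le (l : R) n : 0 <= l ->
  \sum_(j < n) (if j.+1%:R <= l then 1 else 0) <= l.
Proof.
move=> l0; elim: n => [|n IH]; first by rewrite big_ord0.
case: (leP n.+1%:R l) => h; last first.
  by rewrite big_ord_recr /= ltNge in h *; rewrite (negbTE h) addr0.
apply: le_trans h; apply: (@le_trans _ _ (\sum_(j < n.+1) 1)).
  by apply: ler_sum => j _; case: ifP.
by rewrite sumr_const card_ord.
Qed.

End counting.

Section matchings.
Context (R : realType) (d : nat).
Local Notation V := (d.-tuple R).
Local Notation T2 := (d.-tuple R * d.-tuple R)%type.

(** The distance between the two points of a pair. *)
Definition dist (p : T2) : R := enorm (tsub p.1 p.2).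

Lemma dist_ge0 p : 0 <= dist p. Proof. exact: sqrtr_ge0. Qed.

Lemma coord_le_dist (p : T2) (i : 'I_d) : `|tnth p.1 i - tnth p.2 i| <= dist p.
Proof.
rewrite -sqrtr_sqr ler_sqrt; last by apply: sumr_ge0 => j _; exact: sqr_ge0.
rewrite (bigD1 i) //= /tsub tnth_mktuple lerDl.
by apply: sumr_ge0 => j _; exact: sqr_ge0.
Qed.

Lemma dist_shift z (p : T2) : dist (diag_shift z p) = dist p.
Proof.
rewrite /dist /enorm; congr Num.sqrt; apply: eq_bigr => i _.
by rewrite /tsub /diag_shift /tadd /= !tnth_mktuple; congr (_ ^+ 2); ring.
Qed.

Lemma measurable_coord1 (i : 'I_d) :
  measurable_fun [set: T2] (fun p => tnth p.1 i).
Proof.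
by apply: (measurableT_comp (@measurable_tnth _ R d i)); exact: measurable_fst.
Qed.

Lemma measurable_coord2 (i : 'I_d) :
  measurable_fun [set: T2] (fun p => tnth p.2 i).
Proof.
by apply: (measurableT_comp (@measurable_tnth _ R d i)); exact: measurable_snd.
Qed.

Lemma measurable_dist : measurable_fun [set: T2] dist.
Proof.
apply: (measurableT_comp (continuous_measurable_fun (@sqrt_continuous R))).
apply: measurable_sum => i; apply: measurable_funX.
rewrite (_ : (fun _ => _) = fun p : T2 => tnth p.1 i - tnth p.2 i); last first.
  by apply/funext => p; rewrite /tsub tnth_mktuple.
by apply: measurable_funB; [exact: measurable_coord1|exact: measurable_coord2].
Qed.

Lemma measurable_unit_cube : measurable (@unit_cube R d).
Proof. exact: measurable_box. Qed.

Lemma measurable_rect (A B : set V) : measurable A -> measurable B ->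
  measurable (A `*` B).
Proof. exact: measurableX. Qed.

(** Pairs whose first point is in the unit cube and whose distance is at least
    [k]. *)
Definition far (k : nat) : set T2 :=
  [set p | unit_cube p.1 /\ k%:R <= dist p].

Lemma measurable_far k : measurable (far k).
Proof.
rewrite (_ : far k = (@unit_cube R d `*` setT) `&` [set p | k%:R <= dist p]).
  apply: measurableI; first by apply: measurable_rect => //; exact: measurable_unit_cube.
  by apply: measurable_ge; exact: measurable_dist.
by apply/seteqP; split => p /= [] => [a b|[a _] b].
Qed.

Section one_configuration.
Variable mu : {measure set T2 -> \bar R}.

Let integrand (p : T2) : R := dist p * \1_(@unit_cube R d) p.1.

Let measurable_integrand : measurable_fun [set: T2] integrand.
Proof.
apply: measurable_funM; first exact: measurable_dist.
apply: (measurableT_comp (f := \1_(@unit_cube R d) : V -> R)).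
  by apply: measurable_indic; exact: measurable_unit_cube.
exact: measurable_fst.
Qed.

Let integrand_ge0 p : 0 <= integrand p.
Proof. by rewrite mulr_ge0 // dist_ge0. Qed.

Lemma total_distance_ge0 : (0 <= total_distance mu)%E.
Proof. by apply: integral_ge0 => p _; rewrite lee_fin integrand_ge0. Qed.

Lemma sum_far_le n :
  (\sum_(j < n) mu (far j.+1) <= total_distance mu)%E.
Proof.
rewrite (eq_bigr (fun j : 'I_n => \int[mu]_p (\1_(far j.+1) p)%:E)%E); last first.
  by move=> j _; rewrite integral_indic ?setIT //; exact: measurable_far.
have mi j : measurable_fun [set: T2] (\1_(far j.+1) : T2 -> R).
  by apply: measurable_indic; exact: measurable_far.
rewrite -(expect_sum mu (f := fun j p => \1_(far j.+1) p)) //.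
apply: (expect_le mu) => //.
- exact: measurable_sum.
- by move=> p; apply: sumr_ge0.
move=> p; rewrite indicE; case: (boolP (p.1 \in _)) => hp; last first.
  rewrite mulr0 big1 // => j _; rewrite indicE memNset //= => -[h _].
  by move: hp; rewrite notin_setE.
rewrite mulr1; apply: le_trans (count_le n (dist_ge0 p)).
rewrite le_eqVlt; apply/orP; left; apply/eqP; apply: eq_bigr => j _.
rewrite indicE; case: ifP => h; first by rewrite mem_set //=; split => //; exact: set_mem.
by rewrite memNset //= => -[_]; rewrite h.
Qed.

Lemma far_le_total_distance k :
  (k%:R%:E * mu (far k) <= total_distance mu)%E.
Proof.
rewrite -(setIT (far k)) -(integral_indic mu measurableT (measurable_far k)).
rewrite -(expectZ mu) //; last by apply: measurable_indic; exact: measurable_far.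
apply: (expect_le mu) => //.
  by apply: measurable_funM => //; apply: measurable_indic; exact: measurable_far.
move=> p; rewrite [\1_(far k) p]indicE; case: (boolP (p \in _)); last first.
  by rewrite mulr0 integrand_ge0.
by rewrite inE => -[h1 h2]; rewrite mulr1 indicE mem_set // mulr1.
Qed.

End one_configuration.

Section random_matching.
Context (dO : measure_display) (Omega : measurableType dO)
  (P : probability Omega R).
Variables (N N' : R.-ker Omega ~> V) (M : R.-ker Omega ~> T2).
Hypothesis hM : translation_invariant_matching P N' N M.

Lemma measurable_total_distance :
  measurable_fun [set: Omega] (fun w => total_distance (M w)).
Proof.
apply: (@measurable_fun_integral_kernel _ _ _ _ R (fun w => M w)).
- by move=> U mU; exact: measurable_kernel.
- by move=> p; rewrite lee_fin mulr_ge0 // sqrtr_ge0.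
apply/measurable_EFinP; apply: measurable_funM; first exact: measurable_dist.
apply: (measurableT_comp (f := \1_(@unit_cube R d) : V -> R)).
  by apply: measurable_indic; exact: measurable_unit_cube.
exact: measurable_fst.
Qed.

Lemma measurable_preshift z (U : set T2) : measurable U ->
  measurable (diag_shift z @^-1` U).
Proof.
by move=> mU; rewrite -[X in measurable X]setTI; exact: measurable_diag_shift.
Qed.

Lemma shift_integral z (F : config R T2 -> \bar R) :
  measurable_fun [set: config R T2] F -> (forall mu, 0 <= F mu)%E ->
  (\int[P]_w F (shift_measure z (M w)) = \int[P]_w F (M w))%E.
Proof.
move=> mF F0; case: hM => _ hz _ _.
apply: same_law_integral => //.
  by move=> A mA; apply: measurable_kernel; exact: measurable_preshift.
by move=> A mA; exact: measurable_kernel.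
Qed.

(** The expected number of edges in [U]. *)
Definition intensity (U : set T2) : \bar R := (\int[P]_w M w U)%E.

Lemma intensity_shift z U : measurable U ->
  intensity (diag_shift z @^-1` U) = intensity U.
Proof.
move=> mU; apply: (@shift_integral z (fun mu => (mu : {measure set T2 -> \bar R}) U)).
  exact: measurable_eval.
by move=> mu; exact: measure_ge0.
Qed.

Lemma shift_positive z (U : set T2) : measurable U ->
  P [set w | (0 < M w (diag_shift z @^-1` U))%E] = P [set w | (0 < M w U)%E].
Proof.
move=> mU; case: hM => _ hz _ _.
pose C := [set mu : {measure set T2 -> \bar R} | (0 < mu U)%E].
apply: (hz z C); apply: sub_sigma_algebra; exists U => //.
exists `]0%E, +oo[%classic; first exact: emeasurable_itv.
rewrite setTI; apply/seteqP; split => mu; by rewrite /C /= in_itv /= andbT.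
Qed.

Lemma measurable_positive (U : set T2) : measurable U ->
  measurable [set w | (0 < M w U)%E].
Proof.
move=> mU; rewrite -[X in measurable X]setTI.
have -> : [set w | (0 < M w U)%E] = (fun w => M w U) @^-1` `]0%E, +oo[%classic.
  by apply/seteqP; split => w /=; rewrite in_itv /= andbT.
by apply: measurable_kernel => //; exact: emeasurable_itv.
Qed.

(** The mass of [far k] cannot be strictly between [0] and [1], because [M] is
    integer-valued on the bounded parts of [far k]. *)
Lemma far_positive k :
  {ae P, forall w, (0 < M w (far k))%E -> (k%:R%:E <= total_distance (M w))%E}.
Proof.
case: hM => -[hint _] _ _ _; move: hint; apply: filterS => w hw pos.
apply: le_trans (far_le_total_distance (M w) k).
rewrite -[leLHS]mule1 lee_wpmul2l // leNgt; apply/negP => lt1.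
pose B (r : nat) := far k `&`
  ([set p : T2 | enorm p.1 <= r%:R] `&` [set p : T2 | enorm p.2 <= r%:R]).
have mn (f : T2 -> V) r : measurable_fun [set: T2] f ->
    measurable [set p : T2 | enorm (f p) <= r%:R :> R].
  move=> mf; have -> : [set p : T2 | enorm (f p) <= r%:R] =
      [set p : T2 | - r%:R <= - enorm (f p)].
    by apply/seteqP; split => p /=; rewrite lerN2.
  apply: measurable_ge; apply: measurableT_comp => //.
  apply: (measurableT_comp (continuous_measurable_fun (@sqrt_continuous R))).
  apply: measurable_sum => i; apply: measurable_funX.
  exact: (measurableT_comp (@measurable_tnth _ R d i)).
have mB r : measurable (B r).
  apply: measurableI; first exact: measurable_far.
  by apply: measurableI; apply: mn; [exact: measurable_fst|exact: measurable_snd].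
have B0 r : M w (B r) = 0%E.
  have [|n Bn] := hw (B r) (mB r); first by exists r%:R => p [_ []].
  have : (M w (B r) < 1)%E.
    apply: le_lt_trans lt1; apply: le_measure; rewrite ?inE //.
    - exact: measurable_far.
    - by move=> p [].
  by rewrite Bn lte_fin (ltr_nat _ n 1) ltnS leqn0 => /eqP ->.
move: pos; rewrite ltNge => /negP; apply.
apply: (@le_trans _ _ (\sum_(r <oo) M w (B r))%E).
  apply: measure_sigma_subadditive => //; first exact: measurable_far.
  move=> p hp; exists (maxn (Num.bound (enorm p.1)) (Num.bound (enorm p.2))) => //.
  have b (x : V) n : (Num.bound (enorm x) <= n)%N -> enorm x <= n%:R.
    move=> h; apply: ltW; apply: lt_le_trans (archi_boundP (sqrtr_ge0 _)) _.
    by rewrite ler_nat.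
  by split => //; split => /=; apply: b; rewrite ?leq_maxl ?leq_maxr.
by rewrite eseries0.
Qed.

End random_matching.
End matchings.

(** * Edges that leave a segment *)

Section independence_of_counts.
Context (R : realType) (dO : measure_display) (Omega : measurableType dO)
  (P : probability Omega R) (dT : measure_display) (T : measurableType dT).

Lemma independent_counts (N N' : Omega -> {measure set T -> \bar R})
    (A A' : set T) : independent_processes P N N' ->
  measurable A -> measurable A' ->
  independent_pair P (fun w => N w A) (fun w => N' w A').
Proof.
move=> NN' mA mA' Y Y' mY mY'.
apply: (NN' [set mu : {measure set T -> \bar R} | Y (mu A)]
            [set mu : {measure set T -> \bar R} | Y' (mu A')]);
  apply: sub_sigma_algebra; [exists A|exists A'] => //;
  [exists Y|exists Y'] => //; by rewrite setTI.
Qed.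

End independence_of_counts.

Section dimension_one.
Context (R : realType) (dO : measure_display) (Omega : measurableType dO)
  (P : probability Omega R) (N N' : R.-ker Omega ~> 1.-tuple R)
  (M : R.-ker Omega ~> (1.-tuple R * 1.-tuple R)%type).
Hypothesis hN : unit_poisson_process P N.
Hypothesis hN' : unit_poisson_process P N'.
Hypothesis hind : independent_processes P N N'.
Hypothesis hM : translation_invariant_matching P N' N M.

(* The cells [[k, k + 1)], the segment [[0, n)], and the edges that leave the
   segment from its [k]-th cell. *)
Let cell (k : nat) : set (1.-tuple R) := box (fun=> k%:R) (fun=> k.+1%:R).
Let segment (n : nat) : set (1.-tuple R) := box (fun=> 0) (fun=> n%:R).
Let escape n k := cell k `*` ~` segment n.
Let L w := total_distance (M w).

(* The probability that the total distance is at least [j]. *)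
Let q (j : nat) : R := fine (P [set w | (j%:R%:E <= L w)%E]).

Let measurable_L j : measurable [set w | (j%:R%:E <= L w)%E].
Proof.
rewrite -[X in measurable X]setTI.
exact: (emeasurable_fun_c_infty measurableT (measurable_total_distance M)).
Qed.

Let qE j : P [set w | (j%:R%:E <= L w)%E] = (q j)%:E.
Proof. by rewrite fineK // fin_num_measure. Qed.

Let q_ge0 j : 0 <= q j.
Proof. by rewrite -lee_fin -qE. Qed.

Let measurable_escape n k : measurable (escape n k).
Proof.
apply: measurable_rect; first exact: measurable_box.
by apply: measurableC; exact: measurable_box.
Qed.

(** An edge that leaves [[0, n)] from its [k]-th cell is at least as long as the
    distance from that cell to the complement of the segment. *)
Lemma escape_far n k : (k < n)%N ->
  diag_shift [tuple (k%:R : R)] @^-1` escape n k `<=` @far R 1 (minn k (n.-1 - k)).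
Proof.
move=> kn [x y] [/= hx hy].
have := hx ord0; rewrite /tadd /= tnth_mktuple [tnth [tuple _] _]/= => hx0.
split; first by move=> i /=; have := hx0; rewrite (ord1 i) => /andP[a b];
  apply/andP; split; [lra|move: b; rewrite -natr1; lra].
have := @coord_le_dist R 1 (x, y) ord0; rewrite /= => h.
apply: le_trans h.
have ny : ~ (0 <= tnth y ord0 + k%:R < n%:R).
  by move=> h; apply: hy => i; rewrite (ord1 i) /tadd /= tnth_mktuple.
have m1 : (minn k (n.-1 - k))%:R <= k%:R :> R by rewrite ler_nat geq_minl.
have m2 : (minn k (n.-1 - k))%:R + k%:R + 1 <= n%:R :> R.
  by rewrite -natrD natr1 ler_nat; lia.
move: hx0 => /andP[a b]; rewrite -natr1 in b.
rewrite ler_normr; case: (ltP (tnth y ord0 + k%:R) 0) => c; apply/orP.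
  by left; lra.
right; case: (ltP (tnth y ord0 + k%:R) n%:R) => e; last by lra.
by exfalso; apply: ny; rewrite c.
Qed.

Lemma escape_prob n k : (k < n)%N ->
  (P [set w | (0 < M w (escape n k))%E] <= (q k + q (n.-1 - k))%:E)%E.
Proof.
move=> kn; rewrite -(shift_positive hM [tuple (k%:R : R)]) //.
set j := minn k (n.-1 - k).
apply: (@le_trans _ _ (q j)%:E).
  rewrite -qE; apply: ae_le_prob => //.
    by apply: measurable_positive; exact: measurable_preshift.
  move: (far_positive hM j); apply: filterS => w hw /= pos.
  apply: hw; apply: lt_le_trans pos _; apply: le_measure; rewrite ?inE.
  - exact: measurable_preshift.
  - exact: measurable_far.
  - exact: escape_far.
rewrite lee_fin /j /minn; case: ifP => _; rewrite ?lerDl ?lerDr; exact: q_ge0.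
Qed.

Lemma crowded_cell K k :
  (P [set w | (K.+1%:R <= fine (N' w (cell k)))%R] <= ((K.+1)`!%:R^-1)%:E)%E.
Proof.
have hc : poisson_variable P 1 (fun w => N' w (cell k)).
  apply: poisson_variable_box => //; first by move=> i; rewrite ler_nat.
  by rewrite big_ord1 -natr1; ring.
have mB := @measurable_fine_ge R id K.+1%:R (@measurable_id _ _ _).
rewrite (_ : [set w | _] = (fun w => N' w (cell k)) @^-1`
    [set y : \bar R | K.+1%:R <= id (fine y)]) //.
rewrite (poisson_event ltr01 hc mB); have := poisson_tail (@ltr01 R) K.+1.
rewrite expr1n mul1r; apply: le_trans.
apply: poisson_mean_le => // k'; rewrite indicE.
case: (boolP (_ \in _)) => //; rewrite ?inE /=; last by case: ifP.
by rewrite ler_nat => ->.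
Qed.

(** With probability at least [3 / 8] at least [r] edges leave the segment of length
    [(16 r)^2]. Unless some cell contains more than [K] points, this requires [r / K]
    cells from which some edge leaves the segment, and Markov's inequality applies to
    the number of these cells. *)
Lemma segment_discrepancy r K : (0 < r)%N -> (0 < K)%N ->
  3 / 8 <= ((16 * r) ^ 2)%:R * ((K.+1)`!%:R^-1) +
           2 * K%:R / r%:R * \sum_(j < (16 * r) ^ 2) q j.
Proof.
move=> r0 K0; set n := ((16 * r) ^ 2)%N.
have n0 : (0 < n)%N by rewrite /n sqrn_gt0 muln_gt0.
have mS : measurable (segment n) by exact: measurable_box.
have pS (N0 : R.-ker Omega ~> 1.-tuple R) : unit_poisson_process P N0 ->
    poisson_variable P n%:R (fun w => N0 w (segment n)).
  move=> h; apply: poisson_variable_box => //; last by rewrite ltr0n.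
  by rewrite big_ord1 subr0.
have l0 : 0 < n%:R :> R by rewrite ltr0n.
have hX := pS _ hN'; have hY := pS _ hN.
have XY := independent_pairC (independent_counts hind mS mS).
have large := difference_positive r0 hX hY XY.
pose A := [set w | r%:R <= fine (N' w (segment n)) - fine (N w (segment n))].
pose G k := [set w | K.+1%:R <= fine (N' w (cell k))].
pose S k := [set w | (0 < M w (escape n k))%E].
pose f w : R := \sum_(k < n) \1_(S k) w.
pose H := [set w | r%:R / K%:R <= f w].
have mfine (N0 : R.-ker Omega ~> 1.-tuple R) B : measurable B ->
    measurable_fun [set: Omega] (fun w => fine (N0 w B)).
  move=> mB; apply: (measurableT_comp (@fine_measurable R setT _)) => //.
  exact: measurable_kernel.
have mG k : measurable (G k).
  by apply: measurable_ge; apply: mfine; exact: measurable_box.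
have mA : measurable A.
  by apply: measurable_ge; apply: measurable_funB; exact: mfine.
have mSk k : measurable (S k) by exact: measurable_positive.
have mind k : measurable_fun [set: Omega] (\1_(S k) : Omega -> R).
  exact: measurable_indic.
have mf : measurable_fun [set: Omega] f by exact: measurable_sum.
have mH : measurable H by exact: measurable_ge.
have KR : 0 < K%:R :> R by rewrite ltr0n.
have rR : 0 < r%:R :> R by rewrite ltr0n.
have mGU : measurable (\big[setU/set0]_(k < n) G k) by exact: bigsetU_measurable.
have PG : (P (\big[setU/set0]_(k < n) G k) <= (n%:R * ((K.+1)`!%:R^-1))%:E)%E.
  apply: (le_trans (Boole_inequality _ _)) => //.
  apply: (@le_trans _ _ (\sum_(k < n) ((K.+1)`!%:R^-1)%:E)%E).
    by apply: lee_sum => k _; exact: crowded_cell.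
  by rewrite sumEFin sumr_const card_ord lee_fin [leRHS]mulr_natl.
have PH : (P H <= (2 * K%:R / r%:R * \sum_(j < n) q j)%:E)%E.
  apply: prob_ge_le => //.
  - by move=> w; apply: sumr_ge0.
  - exact: divr_gt0.
  rewrite (expect_sum P (f := fun k w => \1_(S k) w)) //.
  apply: (@le_trans _ _ (\sum_(k < n) (q k + q (n.-1 - k))%:E)%E).
    apply: lee_sum => k _; rewrite integral_indic // setIT.
    exact: escape_prob.
  rewrite sumEFin lee_fin big_split /=.
  have -> : \sum_(i < n) q (n.-1 - i) = \sum_(i < n) q i.
    rewrite (reindex_inj rev_ord_inj) /=; apply: eq_bigr => i _.
    by congr q; have := ltn_ord i; lia.
  rewrite le_eqVlt; apply/orP; left; apply/eqP; field.
  by rewrite !lt0r_neq0.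
rewrite -lee_fin; apply: (le_trans large); rewrite EFinD.
apply: le_trans (leeD PG PH).
apply: (le_trans _ (measureU2 P mGU mH)).
apply: ae_le_prob => //; first exact: measurableU.
have cellN k : {ae P, forall w, exists m : nat, N' w (cell k) = m%:R%:E}.
  apply: (@poisson_integer _ _ _ _ 1) => //; apply: poisson_variable_box => //.
    by move=> i; rewrite ler_nat.
  by rewrite big_ord1 -natr1; ring.
have cells : {ae P, forall w, forall k, exists m : nat, N' w (cell k) = m%:R%:E}.
  exact/ae_foralln.
case: (hM) => _ _ marg1 marg2.
move: (ae_and (ae_and (poisson_integer l0 hX) (poisson_integer l0 hY))
  (ae_and cells (ae_and marg1 marg2))).
apply: filterS => w [[[x hx] [y hy]] [hc [h1 h2]]].
rewrite /A /= hx hy /= => xy.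
case: (pselect ((\big[setU/set0]_(k < n) G k) w)) => [h|notG]; [by left|right].
have few k : (k < n)%N -> (M w (escape n k) <= (K%:R * \1_(S k) w)%:E)%E.
  move=> kn; rewrite indicE; case: (boolP (w \in S k)) => [_|].
    rewrite mulr1; apply: (@le_trans _ _ (N' w (cell k))).
      rewrite -h1; last exact: measurable_box.
      apply: le_measure; rewrite ?inE //.
      - by apply: measurable_rect => //; exact: measurable_box.
      - by move=> p [a _]; split.
    have [m hm] := hc k; rewrite hm lee_fin ler_nat leqNgt; apply/negP => Km.
    apply: notG; rewrite -bigcup_mkord; exists k => //.
    by rewrite /G /= hm ler_nat.
  by rewrite mulr0 notin_setE /S /= => /negP; rewrite -leNgt.
have mM (B B' : set (1.-tuple R)) : measurable B -> measurable B' -> measurable (B `*` B').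
  exact: measurable_rect.
have mSc : measurable (~` segment n) by exact: measurableC.
have esc : (M w (segment n `*` ~` segment n) <= (K%:R * f w)%:E)%E.
  apply: (@le_trans _ _ (\sum_(k < n) (K%:R * \1_(S k) w)%:E)%E); last first.
    by rewrite sumEFin -mulr_sumr.
  apply: (@le_trans _ _ (\sum_(k < n) M w (escape n k))%E); last first.
    by apply: lee_sum => k _; exact: few.
  apply: le_trans (Boole_inequality _ _) => //.
  apply: le_measure; rewrite ?inE; [exact: mM|exact: bigsetU_measurable|].
  move=> p [/= a b]; rewrite -bigcup_mkord.
  have /andP[a0 an] := a ord0.
  have [k kn /andP[c1 c2]] : exists2 k, (k < n)%N & k%:R <= tnth p.1 ord0 < k.+1%:R.
    exists (Num.truncn (tnth p.1 ord0)); last exact: truncn_itv.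
    by rewrite -(ltr_nat R) (le_lt_trans _ an) // truncn_le.
  by exists k => //; split => //= i; rewrite (ord1 i) c1.
have : (x%:R%:E <= y%:R%:E + (K%:R * f w)%:E)%E.
  rewrite -hx -h1 //; apply: (@le_trans _ _ (M w (segment n `*` segment n) +
      M w (segment n `*` ~` segment n))%E).
    apply: le_trans (measureU2 _ (mM _ _ mS mS) (mM _ _ mS mSc)).
    apply: le_measure; rewrite ?inE; [exact: mM|apply: measurableU; exact: mM|].
    move=> p [/= a _]; case: (pselect (segment n p.2)) => b; [by left|by right].
  apply: leeD => //; rewrite -hy -h2 //; apply: le_measure; rewrite ?inE; try exact: mM.
  by move=> p [_ a]; split.
by rewrite -EFinD lee_fin /H /= ler_pdivrMr // => h; lra.
Qed.

End dimension_one.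

(** * Dimension one *)

Section dyadic_sums.
Context (R : realType).

(** Two geometric series that meet where [2 ^+ s] is about [t]. *)
Lemma dyadic_min_sum (t : R) n : 0 <= t ->
  \sum_(s < n) Num.min (2 ^+ s) (t ^+ 2 / 2 ^+ s) <= 4 * t.
Proof.
move=> t0; set f := fun s : nat => Num.min (2 ^+ s) (t ^+ 2 / 2 ^+ s).
have p s : 0 < 2 ^+ s :> R by rewrite exprn_gt0.
have [h1 h2] : \sum_(s < n) f s <= 2 ^+ n /\
    (t < 2 ^+ n -> \sum_(s < n) f s <= 4 * t - 2 * (t ^+ 2 / 2 ^+ n)).
  elim: n => [|n [IH1 IH2]].
    rewrite big_ord0 expr0; split => // t1; rewrite divr1.
    have := mulr_ge0 t0 (ltW (_ : 0 < 1 - t)); rewrite subr_gt0 => /(_ t1).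
    by rewrite expr2; lra.
  rewrite big_ord_recr /=.
  have m1 : f n <= 2 ^+ n by rewrite /f ge_min lexx.
  have m2 : f n <= t ^+ 2 / 2 ^+ n by rewrite /f ge_min lexx orbT.
  split; first by rewrite exprS; lra.
  move=> tn; have -> : 2 * (t ^+ 2 / 2 ^+ n.+1) = t ^+ 2 / 2 ^+ n.
    by rewrite [2 ^+ n.+1]exprS; field; rewrite lt0r_neq0.
  case: (ltP t (2 ^+ n)) => h; first by have := IH2 h; lra.
  have {}tn : t < 2 * 2 ^+ n by rewrite -exprS.
  apply: (@le_trans _ _ (2 * 2 ^+ n)); first by lra.
  have pn := p n; move: (2 ^+ n) pn h tn {IH1 IH2 m1 m2} => u u0 ut tu.
  rewrite lerBrDr -lerBrDl ler_pdivrMr // expr2; nra.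
case: (ltP t (2 ^+ n)) => h.
  by apply: (le_trans (h2 h)); rewrite gerBl mulr_ge0 // divr_ge0 ?sqr_ge0 // ltW.
by apply: (le_trans h1); lra.
Qed.

Lemma harmonic_unbounded (c B : R) : 0 < c ->
  ~ (forall n, \sum_(s < n) c / s.+1%:R <= B).
Proof.
move=> c0 hB; apply: (@dvg_harmonic R); apply: nondecreasing_is_cvgn.
  apply/nondecreasing_seqP => n; rewrite /series /= big_nat_recr //= lerDl.
  by rewrite /harmonic invr_ge0.
exists (B / c) => _ [n _ <-]; rewrite ler_pdivlMr // mulrC.
apply: le_trans (hB n); rewrite /series /= big_mkord mulr_sumr.
by apply: ler_sum => i _.
Qed.

Lemma pow2_le_fact k : (2 ^ k <= k.+1`!)%N.
Proof.
elim: k => // k IH; rewrite expnS factS; apply: leq_mul => //.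
Qed.

Lemma count_lt (l : R) n : 0 <= l ->
  \sum_(j < n) (if j%:R <= l then 1 else 0) <= 1 + l.
Proof.
move=> l0; case: n => [|n]; first by rewrite big_ord0; lra.
by rewrite big_ord_recl /= l0 lerD2l; exact: count_le.
Qed.

End dyadic_sums.

Section dimension_one_conclusion.
Context (R : realType) (dO : measure_display) (Omega : measurableType dO)
  (P : probability Omega R) (N N' : R.-ker Omega ~> 1.-tuple R)
  (M : R.-ker Omega ~> (1.-tuple R * 1.-tuple R)%type).
Hypothesis hN : unit_poisson_process P N.
Hypothesis hN' : unit_poisson_process P N'.
Hypothesis hind : independent_processes P N N'.
Hypothesis hM : translation_invariant_matching P N' N M.

Let L w := total_distance (M w).
(* The probability that the total distance is at least [j]. *)
Let tail (j : nat) : R := fine (P [set w | (j%:R%:E <= L w)%E]).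

(** The choice [r = 2^s] and [K = 2 s + 11] in [segment_discrepancy] makes the
    probability of a crowded cell at most [1 / 8]. *)
Lemma tail_sum s :
  (88 * s.+1%:R)^-1 <= (2 ^+ s)^-1 * \sum_(j < (16 * 2 ^ s) ^ 2) tail j.
Proof.
have r0 : (0 < 2 ^ s)%N by rewrite expn_gt0.
have K0 : (0 < 2 * s + 11)%N by rewrite addn_gt0 orbT.
have := segment_discrepancy hN hN' hind hM r0 K0.
set S := \sum_(j < _) _; move=> h.
have h1 : ((16 * 2 ^ s) ^ 2)%:R * ((2 * s + 11).+1`!%:R^-1) <= 8^-1 :> R.
  rewrite ler_pdivrMr ?ltr0n ?fact_gt0 // mulrC ler_pdivlMr // -natrM ler_nat.
  rewrite (_ : 16 * 2 ^ s = 2 ^ (s + 4))%N; last by rewrite expnD; lia.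
  rewrite -expnM (_ : 8 = 2 ^ 3)%N // -expnD.
  apply: leq_trans (pow2_le_fact (2 * s + 11)); rewrite leq_exp2l //; lia.
have p : 0 < 2 ^+ s :> R by rewrite exprn_gt0.
have e : 2 * (2 * s + 11)%:R / (2 ^ s)%:R * S =
   2 * (2 * s + 11)%:R * ((2 ^+ s)^-1 * S) by rewrite natrX; ring.
rewrite e in h; rewrite -/S; move: ((2 ^+ s)^-1 * S) h h1 => x h h1.
have h2 : 8^-1 <= (2 * s + 11)%:R * x by lra.
have kp : 0 < (2 * s + 11)%:R :> R by rewrite ltr0n addn_gt0 orbT.
have x0 : 0 < x by rewrite -(pmulr_rgt0 _ kp); lra.
have h3 : (2 * s + 11)%:R * x <= (11 * s.+1)%:R * x.
  by rewrite ler_pM2r // ler_nat; lia.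
rewrite natrM in h3; have sp : 0 < s.+1%:R :> R by rewrite ltr0n.
rewrite -[leLHS]mul1r ler_pdivrMr ?mulr_gt0 //; lra.
Qed.

Lemma dimension_one : (\int[P]_w (total_distance (M w) `^ (1%:R / 2)) = +oo)%E.
Proof.
apply/eqP; rewrite eq_le leey /= leNgt; apply/negP => fin.
have mL : measurable_fun [set: Omega] L by exact: measurable_total_distance.
have L0 w : (0 <= L w)%E by exact: total_distance_ge0.
have mLr : measurable_fun [set: Omega] (fun w => L w `^ (1%:R / 2))%E.
  exact: (measurableT_comp (measurable_poweR _) mL).
have Lr0 w : (0 <= L w `^ (1%:R / 2))%E by exact: poweR_ge0.
have Lfin : {ae P, forall w, L w \is a fin_num}.
  have : P.-integrable setT (fun w => L w `^ (1%:R / 2))%E.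
    apply/integrableP; split => //.
    by under eq_integral do rewrite gee0_abs //.
  move=> /(integrable_ae measurableT); apply: filterS => w /(_ Logic.I).
  rewrite !ge0_fin_numE //; apply: lty_poweRy.
  by rewrite lt0r_neq0 // divr_gt0.
pose l w := fine (L w).
have l0 w : 0 <= l w by exact: fine_ge0.
have ml : measurable_fun [set: Omega] l.
  exact: (measurableT_comp (@fine_measurable R setT measurableT) mL).
pose C := fine (\int[P]_w (L w `^ (1%:R / 2)))%E.
have ClE : (\int[P]_w (L w `^ (1%:R / 2)) = C%:E)%E.
  by rewrite fineK // ge0_fin_numE //; exact: integral_ge0.
have msq (c : R) : measurable_fun [set: Omega] (fun w => Num.sqrt (l w + c)).
  apply: (measurableT_comp (continuous_measurable_fun (@sqrt_continuous R))).
  exact: measurable_funD.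
have sqrtC : (\int[P]_w (Num.sqrt (l w + 0))%:E <= C%:E)%E.
  rewrite -ClE; apply: ge0_le_integral => //.
  - exact/measurable_EFinP.
  - move=> w _; rewrite addr0 /l; have := L0 w; case: (L w) => [x x0| _|//] /=.
      by rewrite mul1r powR12_sqrt.
    by rewrite gt_eqF ?leey // divr_gt0.
pose n s := ((16 * 2 ^ s) ^ 2)%N.
pose A j := [set w | j%:R <= l w].
have mA j : measurable (A j) by exact: measurable_ge.
pose f s w : R := (2 ^+ s)^-1 * \sum_(j < n s) \1_(A j) w.
have mi j : measurable_fun [set: Omega] (\1_(A j) : Omega -> R).
  exact: measurable_indic.
have mf s : measurable_fun [set: Omega] (f s).
  by apply: measurable_funM => //; exact: measurable_sum.
have p s : 0 < 2 ^+ s :> R by rewrite exprn_gt0.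
have f0 s w : 0 <= f s w.
  by rewrite mulr_ge0 ?invr_ge0 ?(ltW (p s)) //; apply: sumr_ge0.
(* the weighted counts over all scales add up to at most a multiple of [1 + sqrt l] *)
have fs m w : \sum_(s < m) f s w <= 64 * (1 + Num.sqrt (l w + 0)).
  pose t := Num.sqrt (l w + 1) / 16.
  have lw1 : 0 <= l w + 1 by rewrite addr_ge0.
  have t0 : 0 <= t by rewrite divr_ge0 // sqrtr_ge0.
  have t2 : t ^+ 2 = (l w + 1) / 256.
    by rewrite /t expr_div_n sqr_sqrtr //; congr (_ / _); ring.
  have ht : Num.sqrt (l w + 1) <= 1 + Num.sqrt (l w + 0).
    have := sqrt_minkowski 1 0 0 (Num.sqrt (l w)); rewrite addr0 add0r expr1n.
    by rewrite !expr0n /= add0r addr0 sqr_sqrtr // sqrtr1 addrC addr0.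
  apply: (@le_trans _ _ (256 * (4 * t))); last by rewrite /t; lra.
  apply: le_trans (ler_wpM2l (_ : 0 <= 256) (dyadic_min_sum m t0)) => //.
  rewrite mulr_sumr; apply: ler_sum => s _; rewrite /f.
  have c1 : \sum_(j < n s) \1_(A j) w <= 1 + l w.
    apply: le_trans (count_lt (n s) (l0 w)).
    apply: ler_sum => j _; rewrite indicE; case: (boolP (w \in _)) => //.
      by rewrite inE /A /= => ->.
    by case: ifP.
  have c2 : \sum_(j < n s) \1_(A j) w <= 256 * (2 ^+ s * 2 ^+ s) :> R.
apply: (@le_trans _ _ (\sum_(j < n s) (1 : R))).
      by apply: ler_sum => j _; rewrite indicE; case: (w \in _).
    rewrite sumr_const card_ord /n natrX natrM natrX.
    by rewrite le_eqVlt; apply/orP; left; apply/eqP; ring.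
  have m1 : (2 ^+ s)^-1 * \sum_(j < n s) \1_(A j) w <= 256 * 2 ^+ s :> R.
    by rewrite mulrC ler_pdivrMr // -mulrA.
  have m2 : (2 ^+ s)^-1 * \sum_(j < n s) \1_(A j) w <= 256 * (t ^+ 2 / 2 ^+ s).
    rewrite mulrC ler_pdivrMr // (_ : _ * _ = 1 + l w) // t2; field.
    by rewrite lt0r_neq0.
  by rewrite /Num.min; case: ifP.
have Ef s : (((88 * s.+1%:R)^-1)%:E <= \int[P]_w (f s w)%:E)%E.
  apply: (@le_trans _ _ ((2 ^+ s)^-1 * \sum_(j < n s) tail j)%:E).
    by rewrite lee_fin; exact: tail_sum.
  rewrite expectZ //; last 2 first.
  - exact: measurable_sum.
  - by move=> w; exact: sumr_ge0.
  rewrite (expect_sum P (f := fun j w => \1_(A j) w)) // EFinM.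
  rewrite lee_pmul2l // ?lte_fin ?invr_gt0 // -sumEFin.
  apply: lee_sum => j _; rewrite integral_indic // setIT.
  have mT : measurable [set w | (j%:R%:E <= L w)%E].
    rewrite -[X in measurable X]setTI.
    exact: (emeasurable_fun_c_infty measurableT mL).
  rewrite /tail fineK ?fin_num_measure //.
  apply: ae_le_prob => //; move: Lfin; apply: filterS => w hw.
  by rewrite /A /l /= -[X in (_ <= X)%E]fineK // lee_fin.
apply: (@harmonic_unbounded R 88^-1 (64 * (1 + C))) => // m.
rewrite -lee_fin -sumEFin.
apply: (@le_trans _ _ (\sum_(s < m) \int[P]_w (f s w)%:E)%E).
  by apply: lee_sum => s _; rewrite -invfM; exact: Ef.
rewrite -(expect_sum P) //.
apply: (@le_trans _ _ (\int[P]_w (64 * (1 + Num.sqrt (l w + 0)))%:E)%E).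
  apply: expect_le => //.
  - exact: measurable_sum.
  - by apply: measurable_funM => //; exact: measurable_funD.
  - by move=> w; apply: sumr_ge0.
have s0 w : 0 <= Num.sqrt (l w + 0) by exact: sqrtr_ge0.
have m1 : measurable_fun [set: Omega] (fun w => 1 + Num.sqrt (l w + 0)).
  exact: measurable_funD.
have p1 w : 0 <= 1 + Num.sqrt (l w + 0) by exact: addr_ge0.
rewrite (expectZ P m1) //.
rewrite (expectD P (measurable_cst (1 : R)) (msq 0)) // expect_cst.
rewrite EFinM lee_pmul2l // ?lte_fin //.
by rewrite EFinD; exact: leeD.
Qed.

End dimension_one_conclusion.

(** * Expected numbers of crossings *)

Section intensity_sums.
Context (R : realType) (d : nat) (dO : measure_display) (Omega : measurableType dO)
  (P : probability Omega R).
Variable M : R.-ker Omega ~> (d.-tuple R * d.-tuple R)%type.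
Local Notation T2 := (d.-tuple R * d.-tuple R)%type.

Lemma intensity_subadditive (U : set T2) (W : nat -> set T2) : measurable U ->
  (forall n, measurable (W n)) -> U `<=` \bigcup_n W n ->
  (intensity P M U <= \sum_(n <oo) intensity P M (W n))%E.
Proof.
move=> mU mW UW; rewrite /intensity -integral_nneseries //; last first.
  by move=> n; exact: measurable_kernel.
apply: ge0_le_integral => //.
- exact: measurable_kernel.
- by apply: ge0_emeasurable_sum => n *; [exact: measure_ge0|exact: measurable_kernel].
- by move=> w _; exact: measure_sigma_subadditive.
Qed.

Lemma intensity_superadditive (U : set T2) (W : nat -> set T2) : measurable U ->
  (forall n, measurable (W n)) -> trivIset setT W -> (forall n, W n `<=` U) ->
  (\sum_(n <oo) intensity P M (W n) <= intensity P M U)%E.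
Proof.
move=> mU mW tW WU; rewrite /intensity -integral_nneseries //; last first.
  by move=> n; exact: measurable_kernel.
apply: ge0_le_integral => //.
- by move=> w _; apply: nneseries_ge0.
- by apply: ge0_emeasurable_sum => n *; [exact: measure_ge0|exact: measurable_kernel].
- exact: measurable_kernel.
move=> w _; rewrite -measure_semi_bigcup //; last exact: bigcup_measurable.
apply: le_measure; rewrite ?inE //; first exact: bigcup_measurable.
by move=> p [n _ /WU].
Qed.

End intensity_sums.

Section integer_cells.
Context (R : realType).

Lemma real_floor (x : R) : exists i : int, i%:~R <= x < (i + 1)%:~R.
Proof. by exists (Num.floor x); exact: floor_itv. Qed.

Lemma neg_cell (x : R) : x < 0 -> exists k : nat, 0 <= x + k.+1%:R < 1.
Proof.
move=> x0; have [i /andP[i1 i2]] := real_floor x.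
have : i < 0 by rewrite -(ltr_int R) (le_lt_trans i1).
case: i i1 i2 => // k; rewrite NegzE intrD => i1 i2 _; exists k.
move: i1 i2; rewrite rmorphN /= => i1 i2.
by apply/andP; split; lra.
Qed.

Lemma pos_cell (x : R) : 0 <= x -> exists k : nat, 0 <= x - k%:R < 1.
Proof.
move=> /truncn_itv /andP[a b]; exists (Num.truncn x).
by rewrite -natr1 in b; apply/andP; split; lra.
Qed.

Lemma int_cell_inj (x : R) (i j : int) : i%:~R <= x < (i + 1)%:~R ->
  j%:~R <= x < (j + 1)%:~R -> i = j.
Proof.
move=> /andP[a b] /andP[c e]; apply/eqP; rewrite eq_le.
have := le_lt_trans a e; have := le_lt_trans c b; rewrite !ltr_int => h1 h2.
by apply/andP; split; lia.
Qed.

End integer_cells.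

Section crossings.
Context (R : realType) (dO : measure_display) (Omega : measurableType dO)
  (P : probability Omega R).
Local Notation T2 := (2.-tuple R * 2.-tuple R)%type.
Variables (N N' : R.-ker Omega ~> 2.-tuple R) (M : R.-ker Omega ~> T2).
Hypothesis hM : translation_invariant_matching P N' N M.

Definition X1 (p : T2) := tnth p.1 ord0.
Definition X2 (p : T2) := tnth p.1 ord_max.
Definition Y1 (p : T2) := tnth p.2 ord0.
Definition Y2 (p : T2) := tnth p.2 ord_max.

Lemma measurable_X1 : measurable_fun [set: T2] X1.
Proof. exact: measurable_coord1. Qed.
Lemma measurable_X2 : measurable_fun [set: T2] X2.
Proof. exact: measurable_coord1. Qed.
Lemma measurable_Y1 : measurable_fun [set: T2] Y1.
Proof. exact: measurable_coord2. Qed.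
Lemma measurable_Y2 : measurable_fun [set: T2] Y2.
Proof. exact: measurable_coord2. Qed.

(** The translation vector [(a, b)]. *)
Definition vec (a b : R) : 2.-tuple R := [tuple a; b].

Lemma X1_shift a b p : X1 (diag_shift (vec a b) p) = X1 p + a.
Proof. by rewrite /X1 /diag_shift /tadd tnth_mktuple [tnth (vec a b) _]/=. Qed.
Lemma X2_shift a b p : X2 (diag_shift (vec a b) p) = X2 p + b.
Proof. by rewrite /X2 /diag_shift /tadd tnth_mktuple [tnth (vec a b) _]/=. Qed.
Lemma Y1_shift a b p : Y1 (diag_shift (vec a b) p) = Y1 p + a.
Proof. by rewrite /Y1 /diag_shift /tadd tnth_mktuple [tnth (vec a b) _]/=. Qed.
Lemma Y2_shift a b p : Y2 (diag_shift (vec a b) p) = Y2 p + b.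
Proof. by rewrite /Y2 /diag_shift /tadd tnth_mktuple [tnth (vec a b) _]/=. Qed.
Definition coord_shift := (X1_shift, X2_shift, Y1_shift, Y2_shift).

Lemma X1Y1_dist p : `|X1 p - Y1 p| <= dist p.
Proof. exact: coord_le_dist. Qed.
Lemma X2Y2_dist p : `|X2 p - Y2 p| <= dist p.
Proof. exact: coord_le_dist. Qed.

Lemma ord2P (i : 'I_2) : i = ord0 \/ i = ord_max.
Proof. by case: i => -[|[|//]] hi; [left|right]; exact: val_inj. Qed.

Lemma unit_cube2 (p : T2) : unit_cube p.1 <-> 0 <= X1 p < 1 /\ 0 <= X2 p < 1.
Proof.
split=> [h|[h1 h2] i]; first by split; exact: h.
by case: (ord2P i) => ->.
Qed.

(** The pairs [p] with [c p] in the unit interval [[j, j + 1)] that cross the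
    level [b] upwards when [s p] is replaced by [t p]. *)
Definition crossing (c s t : T2 -> R) (j b : R) : set T2 :=
  [set p | (j <= c p < j + 1) && (s p < b <= t p)].

Lemma measurable_lt_set (f g : T2 -> R) : measurable_fun [set: T2] f ->
  measurable_fun [set: T2] g -> measurable [set p | f p < g p].
Proof.
move=> mf mg; rewrite -[X in measurable X]setTI.
have -> : [set p | f p < g p] = (fun p => f p < g p) @^-1` [set true].
  by apply/seteqP; split => p.
by apply: (measurable_fun_ltr mf mg).
Qed.

Lemma measurable_between (f : T2 -> R) (a b : R) : measurable_fun [set: T2] f ->
  measurable [set p | a <= f p < b].
Proof.
move=> mf; rewrite -[X in measurable X]setTI.
have -> : [set p | a <= f p < b] = f @^-1` `[a, b[%classic.
  by apply/seteqP; split => p /=; rewrite in_itv.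
by apply: mf.
Qed.

Lemma measurable_crossing_gen (c s t : T2 -> R) (a a' b : R) :
  measurable_fun [set: T2] c -> measurable_fun [set: T2] s ->
  measurable_fun [set: T2] t ->
  measurable [set p | (a <= c p < a') && (s p < b <= t p)].
Proof.
move=> mc ms mt.
rewrite (_ : [set p | _] = [set p | a <= c p < a'] `&`
   ([set p | s p < b] `&` [set p | b <= t p])).
  apply: measurableI; first exact: measurable_between.
  apply: measurableI; last exact: measurable_ge.
  exact: (measurable_lt_set ms (measurable_cst b)).
by apply/seteqP; split => p /= => [/and3P[]|[-> [-> ->]]].
Qed.

Lemma strip_additive (mu : {measure set T2 -> \bar R}) (c s t : T2 -> R) (b : R) n :
  measurable_fun [set: T2] c -> measurable_fun [set: T2] s ->
  measurable_fun [set: T2] t ->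
  mu [set p | (0 <= c p < n%:R) && (s p < b <= t p)] =
  (\sum_(j < n) mu (crossing c s t j%:R b))%E.
Proof.
move=> mc ms mt; elim: n => [|n IH].
  rewrite big_ord0 (_ : [set p | _] = set0) ?measure0 //.
  by apply/seteqP; split => p //= => /andP[/andP[a b'] _]; lra.
rewrite big_ord_recr /= -{}IH -measureU; last 3 first.
- exact: measurable_crossing_gen.
- exact: measurable_crossing_gen.
- by apply/seteqP; split => p //= -[/andP[/andP[_ a] _] /andP[/andP[b' _] _]]; lra.
congr (mu _); apply/seteqP; split => p; rewrite /crossing /= -natr1.
  move=> /andP[/andP[a a'] ->]; case: (ltP (c p) n%:R) => h; [left|right].
    by rewrite a.
  by rewrite a'.
have n0 : 0 <= n%:R :> R by [].
by move=> [] /andP[/andP[a a'] ->]; rewrite andbT; apply/andP; split; lra.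
Qed.

(** An upper bound for the expected number of crossings of a unit segment in one
    direction. *)
Definition far_sum : \bar R := (\sum_(k <oo) intensity P M (@far R 2 k))%E.

Let mfar k : measurable (@far R 2 k). Proof. exact: measurable_far. Qed.

(** If [U] is covered by translates of the sets [G k], then its intensity is at most
    the sum of their intensities. *)
Lemma far_cover (U : set T2) (z : nat -> 2.-tuple R) (G : nat -> set T2) :
  measurable U -> (forall k, measurable (G k)) ->
  U `<=` \bigcup_k diag_shift (z k) @^-1` G k ->
  (intensity P M U <= \sum_(k <oo) intensity P M (G k))%E.
Proof.
move=> mU mG UG.
apply: (le_trans (intensity_subadditive P M mU _ UG)).
  by move=> k; exact: measurable_preshift.
rewrite le_eqVlt; apply/orP; left; apply/eqP; apply: eq_eseriesr => k _.
exact: (intensity_shift hM).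
Qed.

(** A pair that crosses an axis whose distance from its first point is between [k]
    and [k + 1] is, after a translation, in [far k]. *)
Lemma crossing_X2_up : (intensity P M (crossing X2 X1 Y1 0 0) <= far_sum)%E.
Proof.
apply: (far_cover (z := fun k => vec k.+1%:R 0)) => //.
  by apply: measurable_crossing_gen; [exact: measurable_X2|exact: measurable_X1|
    exact: measurable_Y1].
move=> p; rewrite /crossing /= add0r => /andP[c2 /andP[s t]].
have [k hk] := neg_cell s; exists k => //; split.
  by apply/unit_cube2; rewrite !coord_shift addr0.
rewrite dist_shift; apply: le_trans (X1Y1_dist p).
move: hk; rewrite -natr1 => /andP[a b]; rewrite ler_normr; apply/orP; right; lra.
Qed.

Lemma crossing_X2_down : (intensity P M (crossing X2 Y1 X1 0 0) <= far_sum)%E.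
Proof.
apply: (far_cover (z := fun k => vec (- k%:R) 0)) => //.
  by apply: measurable_crossing_gen; [exact: measurable_X2|exact: measurable_Y1|
    exact: measurable_X1].
move=> p; rewrite /crossing /= add0r => /andP[c2 /andP[s t]].
have [k hk] := pos_cell t; exists k => //; split.
  by apply/unit_cube2; rewrite !coord_shift addr0.
rewrite dist_shift; apply: le_trans (X1Y1_dist p).
move: hk => /andP[a b]; rewrite ler_normr; apply/orP; left; lra.
Qed.

(** As [far k], with the constraint on the first coordinate of the first point
    put on the second point instead. *)
Definition far' (k : nat) : set T2 :=
  [set p | 0 <= Y1 p < 1] `&` ([set p | 0 <= X2 p < 1] `&` [set p | k%:R <= dist p]).

Lemma measurable_far' k : measurable (far' k).
Proof.
apply: measurableI; first by apply: measurable_between; exact: measurable_Y1.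
apply: measurableI; first by apply: measurable_between; exact: measurable_X2.
by apply: measurable_ge; exact: measurable_dist.
Qed.

(** Mass transport in the first coordinate: [far' k] is covered by translates of
    disjoint pieces of [far k], one for each integer part of [X1]. *)
Lemma intensity_far' k : (intensity P M (far' k) <= intensity P M (@far R 2 k))%E.
Proof.
pose W n : set T2 := if (pickle_inv n : option int) is Some i
  then far k `&` [set p | i%:~R <= Y1 p < (i + 1)%:~R] else set0.
pose z n := if (pickle_inv n : option int) is Some i then vec (i%:~R) 0 else vec 0 0.
have mW n : measurable (W n).
  rewrite /W; case: pickle_inv => [i|//]; apply: measurableI => //.
  by apply: measurable_between; exact: measurable_Y1.
apply: (le_trans (far_cover (z := z) (G := W) (measurable_far' k) mW _)).
  move=> p [/= y1 [x2 dk]]; have [j hj] := real_floor (X1 p).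
  have [n hn] : exists n, pickle_inv n = Some (- j).
    by exists (pickle (- j)); rewrite pickleK_inv.
  exists n => //; rewrite /z /W hn /=; split.
    split; last by rewrite dist_shift.
    apply/unit_cube2; rewrite !coord_shift addr0; split => //.
    by move: hj; rewrite intrD rmorphN /= => /andP[a b]; apply/andP; split; lra.
  rewrite /= !coord_shift intrD rmorphN /=.
  by move: y1 => /andP[a b]; apply/andP; split; lra.
apply: intensity_superadditive => //; last first.
  by move=> n; rewrite /W; case: pickle_inv => [i p []|p []].
apply/trivIsetP => m n _ _ mn; rewrite /W.
have := @pickle_invK int m; have := @pickle_invK int n.
case: (pickle_inv m) => [i|]; last by rewrite set0I.
case: (pickle_inv n) => [j|]; last by rewrite setI0.
move=> /= hj hi; apply/seteqP; split => // p [[_ /= a] [_ /= b]].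
by move: mn; rewrite -hi -hj (int_cell_inj a b) eqxx.
Qed.

Lemma far'_sum : (\sum_(k <oo) intensity P M (far' k) <= far_sum)%E.
Proof.
apply: lee_nneseries => k *; last exact: intensity_far'.
by apply: integral_ge0 => w _; exact: measure_ge0.
Qed.

Lemma crossing_Y1_up : (intensity P M (crossing Y1 X2 Y2 0 0) <= far_sum)%E.
Proof.
apply: le_trans far'_sum; apply: (far_cover (z := fun k => vec 0 k.+1%:R)).
- by apply: measurable_crossing_gen; [exact: measurable_Y1|exact: measurable_X2|
    exact: measurable_Y2].
- exact: measurable_far'.
move=> p; rewrite /crossing /= add0r => /andP[c2 /andP[s t]].
have [k hk] := neg_cell s; exists k => //.
split; [|split]; rewrite /= ?coord_shift ?addr0 //.
rewrite dist_shift; apply: le_trans (X2Y2_dist p).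
move: hk; rewrite -natr1 => /andP[a b]; rewrite ler_normr; apply/orP; right; lra.
Qed.

Lemma crossing_Y1_down : (intensity P M (crossing Y1 Y2 X2 0 0) <= far_sum)%E.
Proof.
apply: le_trans far'_sum; apply: (far_cover (z := fun k => vec 0 (- k%:R))).
- by apply: measurable_crossing_gen; [exact: measurable_Y1|exact: measurable_Y2|
    exact: measurable_X2].
- exact: measurable_far'.
move=> p; rewrite /crossing /= add0r => /andP[c2 /andP[s t]].
have [k hk] := pos_cell t; exists k => //.
split; [|split]; rewrite /= ?coord_shift ?addr0 //.
rewrite dist_shift; apply: le_trans (X2Y2_dist p).
move: hk => /andP[a b]; rewrite ler_normr; apply/orP; left; lra.
Qed.

End crossings.

(** * Flows of a matching *)

Section law_of_large_numbers.
Context (R : realType) (dO : measure_display) (Omega : measurableType dO)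
  (P : probability Omega R).

Lemma chebyshev_event (lam c : R) (X : Omega -> \bar R) : 0 < lam -> 0 < c ->
  poisson_variable P lam X ->
  (P [set w | (c <= `|fine (X w) - lam|)%R] <= (lam / c ^+ 2)%:E)%E.
Proof.
move=> l0 c0 hX; pose f y := `|y - lam|.
have mf : measurable_fun [set: R] f.
  by apply: measurableT_comp => //; exact: measurable_funB.
have mB := measurable_fine_ge c mf.
rewrite (_ : [set w | _] = X @^-1` [set y : \bar R | c <= f (fine y)]) //.
rewrite (poisson_event l0 hX mB); apply: le_trans (poisson_chebyshev l0 c0).
apply: poisson_mean_le => // k; rewrite indicE /f.
case: (boolP (_ \in _)) => //; rewrite ?inE /=; last by case: ifP.
by move=> ->.
Qed.

Lemma poisson_difference_vanishes (X Y : nat -> Omega -> \bar R) (n : nat) :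
  (0 < n)%N ->
  (forall m, (0 < m)%N -> poisson_variable P (n * m)%:R (X m)) ->
  (forall m, (0 < m)%N -> poisson_variable P (n * m)%:R (Y m)) ->
  vanishes P (fun m w => (fine (X m w) - fine (Y m w)) / m%:R).
Proof.
move=> n0 hX hY eta e eta0 e0.
have nR : 0 < n%:R :> R by rewrite ltr0n.
pose B := 8 * n%:R / (eta ^+ 2 * e).
have ee : 0 < eta ^+ 2 * e by rewrite mulr_gt0 // exprn_gt0.
have B0 : 0 <= B by rewrite divr_ge0 ?mulr_ge0 // ltW.
exists (Num.bound B) => m Bm.
have m0 : (0 < m)%N by exact: leq_ltn_trans Bm.
have mR : 0 < m%:R :> R by rewrite ltr0n.
pose lam : R := (n * m)%:R; have l0 : 0 < lam by rewrite ltr0n muln_gt0 n0.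
have {}Bm : B <= m%:R.
  by apply: ltW; apply: lt_trans (archi_boundP B0) _; rewrite ltr_nat.
have {}hX := hX m m0; have {}hY := hY m m0.
have mfX : measurable_fun [set: Omega] (fun w => fine (X m w)).
  by apply: (measurableT_comp _ hX.1); exact: fine_measurable.
have mfY : measurable_fun [set: Omega] (fun w => fine (Y m w)).
  by apply: (measurableT_comp _ hY.1); exact: fine_measurable.
pose c := eta * m%:R / 2; have c0 : 0 < c by rewrite divr_gt0 // mulr_gt0.
rewrite (_ : [set w | _] = [set w | c + c <= `|fine (X m w) - fine (Y m w)|]);
  last first.
  rewrite /c -splitr; apply/seteqP; split => w /=;
    by rewrite normrM normfV (ger0_norm (ltW mR)) ler_pdivlMr.
have small : lam / c ^+ 2 <= e / 2.
  rewrite /lam /c natrM ler_pdivrMr ?exprn_gt0 //.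
  have h : 8 * n%:R <= m%:R * (eta ^+ 2 * e) by rewrite -ler_pdivrMr.
  have -> : e / 2 * (eta * m%:R / 2) ^+ 2 =
      m%:R * (eta ^+ 2 * e) * (m%:R / 8) by field.
  have -> : n%:R * m%:R = 8 * n%:R * (m%:R / 8) :> R by field.
  by rewrite ler_pM2r // divr_gt0.
have hs : (e%:E = (e / 2)%:E + (e / 2)%:E)%E by rewrite -EFinD -splitr.
rewrite hs; apply: (@le_trans _ _ ((lam / c ^+ 2)%:E + (lam / c ^+ 2)%:E)%E); last first.
  by apply: leeD; rewrite lee_fin.
apply: le_trans (leeD (chebyshev_event l0 c0 hX) (chebyshev_event l0 c0 hY)).
apply: prob_split.
- exact: measurable_funB.
- exact: measurable_funB.
- exact: measurable_funB.
apply/aeW => w; rewrite [`|fine (Y m w) - lam|]distrC; apply: le_trans (ler_normD _ _).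
by rewrite addrA subrK.
Qed.

End law_of_large_numbers.

Section flows.
Context (R : realType) (dO : measure_display) (Omega : measurableType dO)
  (P : probability Omega R).
Local Notation T2 := (2.-tuple R * 2.-tuple R)%type.
Variables (N N' : R.-ker Omega ~> 2.-tuple R) (M : R.-ker Omega ~> T2).
Hypothesis hM : translation_invariant_matching P N' N M.

(** The net number of pairs with [c] in [[j, j + 1)] that cross the level [b]
    upwards when [s] is replaced by [t]. *)
Definition flow (c s t : T2 -> R) (b j : nat) (w : Omega) : R :=
  fine (M w (crossing c s t j%:R b%:R)) - fine (M w (crossing c t s j%:R b%:R)).

Section one_direction.
Variables (c s t : T2 -> R) (z : nat -> nat -> 2.-tuple R) (K : R).
Hypothesis mc : measurable_fun [set: T2] c.
Hypothesis ms : measurable_fun [set: T2] s.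
Hypothesis mt : measurable_fun [set: T2] t.
Hypothesis cz : forall b j p, c (diag_shift (z b j) p) = c p + j%:R.
Hypothesis sz : forall b j p, s (diag_shift (z b j) p) = s p + b%:R.
Hypothesis tz : forall b j p, t (diag_shift (z b j) p) = t p + b%:R.
Hypothesis upK : (intensity P M (crossing c s t 0 0) <= K%:E)%E.
Hypothesis downK : (intensity P M (crossing c t s 0 0) <= K%:E)%E.

Lemma crossing_shift b j k (s' t' : T2 -> R) :
  (forall p, s' (diag_shift (z b j) p) = s' p + b%:R) ->
  (forall p, t' (diag_shift (z b j) p) = t' p + b%:R) ->
  diag_shift (z b j) @^-1` crossing c s' t' (j + k)%:R b%:R =
  crossing c s' t' k%:R 0.
Proof.
move=> hs ht; apply/seteqP; split => p; rewrite /crossing /= cz hs ht natrD;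
  by move=> /andP[/andP[? ?] /andP[? ?]]; apply/andP; split; apply/andP; split; lra.
Qed.

Let mcr (s' t' : T2 -> R) a b : measurable_fun [set: T2] s' -> measurable_fun [set: T2] t' ->
  measurable (crossing c s' t' a b).
Proof. by move=> *; exact: measurable_crossing_gen. Qed.

Lemma measurable_fine_kernel U : measurable U ->
  measurable_fun [set: Omega] (fun w => fine (M w U)).
Proof.
move=> mU; apply: (measurableT_comp (@fine_measurable R setT measurableT)).
exact: measurable_kernel.
Qed.

Lemma measurable_flow b j : measurable_fun [set: Omega] (flow c s t b j).
Proof. by apply: measurable_funB; apply: measurable_fine_kernel; exact: mcr. Qed.

(** The energies are expectations of functionals of [M], so that translations do not
    change them. *)
Lemma flow_stationary a k n m :
  energy P (flow c s t) a k n m = energy P (flow c s t) 0 0 n m.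
Proof.
pose G (mu : config R T2) (j : nat) : R :=
  fine ((mu : {measure set T2 -> \bar R}) (crossing c s t (k + j)%:R a%:R)) -
  fine ((mu : {measure set T2 -> \bar R}) (crossing c t s (k + j)%:R a%:R)).
pose S mu l := (\sum_(j < l) G mu j) / l%:R.
pose F mu : \bar R := (bracket ((S mu n + S mu m) / 2))%:E.
have mG j : measurable_fun [set: config R T2] (G ^~ j).
  apply: measurable_funB;
    apply: (measurableT_comp (@fine_measurable R setT measurableT));
    by apply: measurable_eval; exact: mcr.
have mS l : measurable_fun [set: config R T2] (S ^~ l).
  by apply: measurable_funM => //; exact: measurable_sum.
have mF : measurable_fun [set: config R T2] F.
  apply/measurable_EFinP; apply: measurable_fun_bracket.
  by apply: measurable_funM => //; exact: measurable_funD.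
have F0 mu : (0 <= F mu)%E by rewrite lee_fin bracket_ge0.
transitivity (\int[P]_w F (M w))%E => //.
rewrite -(shift_integral hM (z a k) mF F0); apply: eq_integral => w _.
have GE j : G (shift_measure (z a k) (M w)) j = flow c s t 0 (0 + j) w.
  transitivity (
    fine (M w (diag_shift (z a k) @^-1` crossing c s t (k + j)%:R a%:R)) -
    fine (M w (diag_shift (z a k) @^-1` crossing c t s (k + j)%:R a%:R))) => //.
  by rewrite !crossing_shift.
rewrite /F /S; under eq_bigr do rewrite GE.
by under [in X in (_ + X / _) / _]eq_bigr do rewrite GE.
Qed.

Lemma intensity_crossing b j (s' t' : T2 -> R) :
  measurable_fun [set: T2] s' -> measurable_fun [set: T2] t' ->
  (forall p, s' (diag_shift (z b j) p) = s' p + b%:R) ->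
  (forall p, t' (diag_shift (z b j) p) = t' p + b%:R) ->
  intensity P M (crossing c s' t' j%:R b%:R) = intensity P M (crossing c s' t' 0 0).
Proof.
move=> ms' mt' hs ht; rewrite -(intensity_shift hM (z b j)) //; last exact: mcr.
by have := @crossing_shift b j 0 s' t' hs ht; rewrite addn0 mulr0n => ->.
Qed.

Lemma intensity_up b j : (intensity P M (crossing c s t j%:R b%:R) <= K%:E)%E.
Proof. by rewrite intensity_crossing. Qed.

Lemma intensity_down b j : (intensity P M (crossing c t s j%:R b%:R) <= K%:E)%E.
Proof. by rewrite intensity_crossing. Qed.

Lemma expect_fine_le U : measurable U ->
  (\int[P]_w (fine (M w U))%:E <= intensity P M U)%E.
Proof.
move=> mU; apply: ge0_le_integral => //.
- by apply/measurable_EFinP; exact: measurable_fine_kernel.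
- exact: measurable_kernel.
- move=> w _; have [Mfin|] := boolP (M w U \is a fin_num).
    by rewrite fineK.
  by rewrite ge0_fin_numE // -leNgt leye_eq => /eqP ->; rewrite leey.
Qed.

Lemma expect_flow b j : (\int[P]_w (`|flow c s t b j w|)%:E <= (K + K)%:E)%E.
Proof.
have m1 := measurable_fine_kernel (mcr j%:R b%:R ms mt).
have m2 := measurable_fine_kernel (mcr j%:R b%:R mt ms).
have p1 w : 0 <= fine (M w (crossing c s t j%:R b%:R)) by rewrite fine_ge0.
have p2 w : 0 <= fine (M w (crossing c t s j%:R b%:R)) by rewrite fine_ge0.
apply: (@le_trans _ _ (\int[P]_w (fine (M w (crossing c s t j%:R b%:R)) +
   fine (M w (crossing c t s j%:R b%:R)))%:E)%E).
  apply: expect_le => //.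
  - by apply: measurableT_comp => //; exact: measurable_flow.
  - exact: measurable_funD.
  - move=> w; apply: (le_trans (ler_normB _ _)).
    by rewrite !ger0_norm.
rewrite expectD // EFinD; apply: leeD.
  exact: le_trans (expect_fine_le (mcr _ _ ms mt)) (intensity_up b j).
exact: le_trans (expect_fine_le (mcr _ _ mt ms)) (intensity_down b j).
Qed.

Lemma intensity_fin U : measurable U -> (intensity P M U <= K%:E)%E ->
  {ae P, forall w, M w U \is a fin_num}.
Proof.
move=> mU UK; have : P.-integrable setT (fun w => M w U).
  apply/integrableP; split; first exact: measurable_kernel.
  under eq_integral do rewrite gee0_abs //.
  exact: le_lt_trans UK (ltry _).
by move=> /(integrable_ae measurableT); apply: filterS => w /(_ Logic.I).
Qed.

Lemma crossings_fin : {ae P, forall w, forall b j,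
  M w (crossing c s t j%:R b%:R) \is a fin_num /\
  M w (crossing c t s j%:R b%:R) \is a fin_num}.
Proof.
apply: ae_foralln => b; apply: ae_foralln => j; apply: ae_and.
  by apply: intensity_fin; [exact: mcr|exact: intensity_up].
by apply: intensity_fin; [exact: mcr|exact: intensity_down].
Qed.

End one_direction.
End flows.

(** * Dimension two *)

Section divergence_identity.
Context (R : realType).
Local Notation T2 := (2.-tuple R * 2.-tuple R)%type.

Local Notation X1 := (@X1 R).
Local Notation X2 := (@X2 R).
Local Notation Y1 := (@Y1 R).
Local Notation Y2 := (@Y2 R).

(** The indicator of a boolean. *)
Definition ind (b : bool) : R := if b then 1 else 0.

Lemma indic_bool (T : Type) (b : T -> bool) (p : T) :
  \1_[set q | b q] p = ind (b p).
Proof.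
rewrite indicE /ind; case: ifP => h; first by rewrite mem_set.
by rewrite memNset //= h.
Qed.

Lemma ind_and (b b' : bool) : ind (b && b') = ind b * ind b'.
Proof. by rewrite /ind; case: b; rewrite ?mul1r ?mul0r. Qed.

Lemma ind_interval (x n : R) : 0 <= n ->
  ind (0 <= x < n) = ind (x < n) - ind (x < 0).
Proof.
move=> n0; case: (ltP x 0) => h /=.
  by rewrite (lt_le_trans h n0) /ind subrr.
by rewrite /ind subr0.
Qed.

Lemma ind_cross (x y b : R) :
  ind (x < b <= y) - ind (y < b <= x) = ind (x < b) - ind (y < b).
Proof.
by case: (ltP x b) => hx; case: (ltP y b) => hy /=; rewrite /ind ?subrr ?subr0 ?sub0r.
Qed.

Variable mu : {measure set T2 -> \bar R}.

Lemma measure5 (A B C D E : set T2) : measurable A -> measurable B ->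
  measurable C -> measurable D -> measurable E ->
  (mu A + mu B + mu C + mu D + mu E =
   \int[mu]_p (\1_A p + \1_B p + \1_C p + \1_D p + \1_E p)%:E)%E.
Proof.
move=> mA mB mC mD mE.
have mi (S : set T2) : measurable S -> measurable_fun [set: T2] (\1_S : T2 -> R).
  exact: measurable_indic.
have m2 := measurable_funD (mi _ mA) (mi _ mB).
have m3 := measurable_funD m2 (mi _ mC).
have m4 := measurable_funD m3 (mi _ mD).
have n2 p : 0 <= (\1_A \+ \1_B : T2 -> R) p by exact: addr_ge0.
have n3 p : 0 <= (\1_A \+ \1_B \+ \1_C : T2 -> R) p by exact: addr_ge0.
have n4 p : 0 <= (\1_A \+ \1_B \+ \1_C \+ \1_D : T2 -> R) p by exact: addr_ge0.
rewrite (expectD mu m4 (mi _ mE)) // (expectD mu m3 (mi _ mD)) //.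
rewrite (expectD mu m2 (mi _ mC)) // (expectD mu (mi _ mA) (mi _ mB)) //.
by rewrite !integral_indic // !setIT.
Qed.

(** The pairs with [c p] in [[0, n)] that cross the level [b] upwards when
    [s p] is replaced by [t p]. *)
Definition strip (c s t : T2 -> R) (n : nat) (b : R) : set T2 :=
  [set p | (0 <= c p < n%:R) && (s p < b <= t p)].

(** The pairs with [(s p, t p)] in [[0, n) x [0, m)]. *)
Definition rectangle (s t : T2 -> R) (n m : nat) : set T2 :=
  [set p | (0 <= s p < n%:R) && (0 <= t p < m%:R)].

(** Each pair is joined by a path that is horizontal, at height [X2], and then
    vertical, at abscissa [Y1]. The number of first points minus the number of second
    points in the rectangle [[0, n) x [0, m)] is the net number of paths that leave it
    through its four sides. The negative terms are moved to the other side, because the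
    equation is between extended reals. *)
Lemma divergence (n m : nat) :
  (mu (rectangle X1 X2 n m) +
   mu (strip X2 Y1 X1 m (n%:R)%R) + mu (strip X2 X1 Y1 m 0%R) +
   mu (strip Y1 Y2 X2 n (m%:R)%R) + mu (strip Y1 X2 Y2 n 0%R) =
   mu (rectangle Y1 Y2 n m) +
   mu (strip X2 X1 Y1 m (n%:R)%R) + mu (strip X2 Y1 X1 m 0%R) +
   mu (strip Y1 X2 Y2 n (m%:R)%R) + mu (strip Y1 Y2 X2 n 0%R))%E.
Proof.
have mX1 := @measurable_X1 R; have mX2 := @measurable_X2 R.
have mY1 := @measurable_Y1 R; have mY2 := @measurable_Y2 R.
have ms (c s t : T2 -> R) k b : measurable_fun [set: T2] c ->
    measurable_fun [set: T2] s -> measurable_fun [set: T2] t ->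
    measurable (strip c s t k b).
  by move=> *; exact: measurable_crossing_gen.
have mr (s t : T2 -> R) (a b : nat) : measurable_fun [set: T2] s ->
    measurable_fun [set: T2] t ->
    measurable (rectangle s t a b).
  move=> h1 h2; rewrite (_ : rectangle s t a b = [set p | 0 <= s p < a%:R] `&`
    [set p | 0 <= t p < b%:R]).
    by apply: measurableI; exact: measurable_between.
  apply/seteqP; split => p /=; first by move=> /andP[].
  by move=> [h3 h4]; apply/andP.
rewrite !measure5; try (exact: ms); try (exact: mr).
apply: eq_integral => p _; congr EFin; rewrite /strip /rectangle !indic_bool.
have e1 := ind_interval (X1 p) (ler0n R n).
have e2 := ind_interval (Y2 p) (ler0n R m).
have e3 := ind_interval (X2 p) (ler0n R m).
have e4 := ind_interval (Y1 p) (ler0n R n).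
have f1 := ind_cross (X1 p) (Y1 p) n%:R.
have f2 := ind_cross (X1 p) (Y1 p) 0.
have f3 := ind_cross (X2 p) (Y2 p) m%:R.
have f4 := ind_cross (X2 p) (Y2 p) 0.
rewrite ![ind (_ && (_ < _ <= _))]ind_and ![ind ((_ <= _ < _) && (_ <= _ < _))]ind_and.
have g1 : ind (0 <= X1 p < n%:R) = ind (0 <= Y1 p < n%:R) +
    (ind (X1 p < n%:R <= Y1 p) - ind (Y1 p < n%:R <= X1 p)) -
    (ind (X1 p < 0 <= Y1 p) - ind (Y1 p < 0 <= X1 p)).
  by rewrite e1 e4 f1 f2; ring.
have g2 : ind (0 <= Y2 p < m%:R) = ind (0 <= X2 p < m%:R) -
    (ind (X2 p < m%:R <= Y2 p) - ind (Y2 p < m%:R <= X2 p)) +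
    (ind (X2 p < 0 <= Y2 p) - ind (Y2 p < 0 <= X2 p)).
  by rewrite e2 e3 f3 f4; ring.
by rewrite g1 g2; ring.
Qed.

End divergence_identity.

Section dimension_two.
Context (R : realType) (dO : measure_display) (Omega : measurableType dO)
  (P : probability Omega R).
Local Notation T2 := (2.-tuple R * 2.-tuple R)%type.
Variables (N N' : R.-ker Omega ~> 2.-tuple R) (M : R.-ker Omega ~> T2).
Hypothesis hN : unit_poisson_process P N.
Hypothesis hN' : unit_poisson_process P N'.
Hypothesis hind : independent_processes P N N'.
Hypothesis hM : translation_invariant_matching P N' N M.

Local Notation X1 := (@X1 R).
Local Notation X2 := (@X2 R).
Local Notation Y1 := (@Y1 R).
Local Notation Y2 := (@Y2 R).

Let box2 (n m : nat) : set (2.-tuple R) :=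
  box (fun=> 0) (fun i => if i == ord0 then n%:R else m%:R).

Let measurable_box2 n m : measurable (box2 n m).
Proof. exact: measurable_box. Qed.

Let box2E n m (x : 2.-tuple R) : box2 n m x <->
  (0 <= tnth x ord0 < n%:R) && (0 <= tnth x ord_max < m%:R).
Proof.
split=> [h|/andP[h1 h2] i]; last by case: (ord2P i) => ->.
by apply/andP; split; [exact: (h ord0)|exact: (h ord_max)].
Qed.

Let poisson_box2 (N0 : R.-ker Omega ~> 2.-tuple R) n m :
  unit_poisson_process P N0 -> (0 < n)%N -> (0 < m)%N ->
  poisson_variable P (n * m)%:R (fun w => N0 w (box2 n m)).
Proof.
move=> h n0 m0; apply: poisson_variable_box => //.
- by move=> i; case: ifP.
- by rewrite big_ord_recl big_ord1 /= !subr0 natrM.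
- by rewrite ltr0n muln_gt0 n0.
Qed.

(** The mean number of points in the unit cube is [1], and the numbers of edges
    from it of length at least [k], for [k >= 1], add up to at most the total
    distance. *)
Lemma far_sum_le : (far_sum P M <= 1 + \int[P]_w total_distance (M w))%E.
Proof.
have mfar k := @measurable_far R 2 k.
rewrite /far_sum nneseries_recl //; last first.
  by move=> k _; apply: integral_ge0 => w _; exact: measure_ge0.
apply: leeD.
  have mB := measurable_box2 1 1.
  have h1 := poisson_box2 hN' (isT : (0 < 1)%N) (isT : (0 < 1)%N).
  have l1 : 0 < (1 * 1)%:R :> R by [].
  rewrite (_ : 1%E = (1 * 1)%:R%:E) // -(poisson_expect l1 h1); last first.
    by move=> w; exact: measure_ge0.
  apply: ae_ge0_le_integral => //.
  - exact: measurable_kernel.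
  - exact: measurable_kernel.
  case: (hM) => _ _ h _; move: h; apply: filterS => w h _.
  rewrite -h //; apply: le_measure; rewrite ?inE //.
    exact: measurable_rect.
  move=> p [/unit_cube2[a b] _]; split => //; apply/box2E.
  by rewrite -[tnth _ _]/(X1 p) -[tnth _ ord_max]/(X2 p) a b.
rewrite -nneseries_addn; last first.
  by move=> k; apply: integral_ge0 => w _; exact: measure_ge0.
rewrite /intensity -integral_nneseries //; last first.
  by move=> k; exact: measurable_kernel.
apply: ge0_le_integral => //.
- by move=> w _; apply: nneseries_ge0.
- by apply: ge0_emeasurable_sum => n *; [exact: measure_ge0|exact: measurable_kernel].
- exact: measurable_total_distance.
move=> w _; apply: lime_le; first by apply: is_cvg_nneseries.
apply: nearW => n; rewrite big_mkord; apply: le_trans (sum_far_le (M w) n).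
by apply: lee_sum => k _; rewrite addn1.
Qed.

Lemma strip_sum (mu : {measure set T2 -> \bar R}) (c s t : T2 -> R) n (b : R) :
  measurable_fun [set: T2] c -> measurable_fun [set: T2] s ->
  measurable_fun [set: T2] t ->
  (forall j : nat, mu (crossing c s t j%:R b) \is a fin_num) ->
  mu (strip c s t n b) = (\sum_(j < n) fine (mu (crossing c s t j%:R b)))%:E.
Proof.
move=> mc ms mt hf; rewrite /strip (strip_additive mu b n mc ms mt) -sumEFin.
by apply: eq_bigr => j _; rewrite fineK.
Qed.

Lemma balance (x y a b c e a' b' c' e' : R) :
  x + a + b + c + e = y + a' + b' + c' + e' ->
  x - y = a' - a - (b - b') + (c' - c - (e - e')).
Proof. by move=> h; lra. Qed.

Lemma dimension_two : (\int[P]_w (total_distance (M w) `^ (2%:R / 2)) = +oo)%E.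
Proof.
have -> : (\int[P]_w (total_distance (M w) `^ (2%:R / 2)) =
           \int[P]_w total_distance (M w))%E.
  apply: eq_integral => w _; rewrite divff // poweRe1 //.
  exact: total_distance_ge0.
apply/eqP; rewrite eq_le leey /= leNgt; apply/negP => fin.
pose K : R := 1 + fine (\int[P]_w total_distance (M w))%E.
have EL0 : (0 <= \int[P]_w total_distance (M w))%E.
  by apply: integral_ge0 => w _; exact: total_distance_ge0.
have farK : (far_sum P M <= K%:E)%E.
  apply: (le_trans far_sum_le); rewrite /K EFinD fineK //.
  by rewrite ge0_fin_numE.
have mX1 := @measurable_X1 R; have mX2 := @measurable_X2 R.
have mY1 := @measurable_Y1 R; have mY2 := @measurable_Y2 R.
(* [h b j] counts crossings of the vertical segment at abscissa [b] over
   [[j, j + 1)], and [v a j] those of the horizontal segment at height [j] over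
   [[a, a + 1)] *)
pose zh (b j : nat) : 2.-tuple R := vec b%:R j%:R.
pose zv (b j : nat) : 2.-tuple R := vec j%:R b%:R.
pose h := flow M X2 X1 Y1.
pose v (a j : nat) := flow M Y1 X2 Y2 j a.
have up_h := le_trans (crossing_X2_up hM) farK.
have down_h := le_trans (crossing_X2_down hM) farK.
have up_v := le_trans (crossing_Y1_up hM) farK.
have down_v := le_trans (crossing_Y1_down hM) farK.
have zX1 b j p : X1 (diag_shift (zh b j) p) = X1 p + b%:R := X1_shift _ _ p.
have zY1 b j p : Y1 (diag_shift (zh b j) p) = Y1 p + b%:R := Y1_shift _ _ p.
have zX2 b j p : X2 (diag_shift (zh b j) p) = X2 p + j%:R := X2_shift _ _ p.
have vX2 b j p : X2 (diag_shift (zv b j) p) = X2 p + b%:R := X2_shift _ _ p.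
have vY2 b j p : Y2 (diag_shift (zv b j) p) = Y2 p + b%:R := Y2_shift _ _ p.
have vY1 b j p : Y1 (diag_shift (zv b j) p) = Y1 p + j%:R := Y1_shift _ _ p.
pose D n m w := fine (N' w (box2 n m)) - fine (N w (box2 n m)).
have mfine (N0 : R.-ker Omega ~> 2.-tuple R) n m :
    measurable_fun [set: Omega] (fun w => fine (N0 w (box2 n m))).
  apply: (measurableT_comp (@fine_measurable R setT measurableT)).
  exact: measurable_kernel.
have mD n m : measurable_fun [set: Omega] (D n m) by exact: measurable_funB.
have box0 n m : (n == 0)%N || (m == 0)%N -> box2 n m = set0.
  move=> nm; apply/seteqP; split => // x /box2E.
  case/orP: nm => /eqP -> /andP[/andP[a b] /andP[c e]].
    by have := le_lt_trans a b; rewrite ltxx.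
  by have := le_lt_trans c e; rewrite ltxx.
have D0 n m w : (n == 0)%N || (m == 0)%N -> D n m w = 0.
  by move=> nm; rewrite /D box0 // !measure0 subrr.
have van0 F : (forall n w, F n w = 0) -> vanishes P F.
  move=> F0 eta e eta0 e0; exists 0%N => n _.
  rewrite (_ : [set w | _] = set0) ?measure0 ?lee_fin ?ltW //.
  by apply/seteqP; split => w //=; rewrite F0 normr0 leNgt eta0.
apply: (@no_balanced_flow _ _ _ P h v (K + K) D).
- by move=> a j; exact: measurable_flow.
- by move=> a j; exact: measurable_flow.
- exact: mD.
- move=> a j; exact: (expect_flow hM mX2 mX1 mY1 zX2 zX1 zY1 up_h down_h).
- move=> a j; exact: (expect_flow hM mY1 mX2 mY2 vY1 vX2 vY2 up_v down_v).
- move=> a k n m; exact: (flow_stationary hM mX2 mX1 mY1 zX2 zX1 zY1).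
- move=> a k n m; exact: (flow_stationary hM mY1 mX2 mY2 vY1 vX2 vY2).
- move=> n m; have [n0|n0] := posnP n.
    rewrite n0; apply/aeW => w; rewrite D0 ?eqxx // big_ord0 addr0 big1 //.
    by move=> j _; rewrite subrr.
  have [m0|m0] := posnP m.
    rewrite m0; apply/aeW => w; rewrite D0 ?eqxx ?orbT // big_ord0 add0r big1 //.
    by move=> j _; rewrite subrr.
  have l0 : 0 < (n * m)%:R :> R by rewrite ltr0n muln_gt0 n0.
  have hX := poisson_box2 hN' n0 m0; have hY := poisson_box2 hN n0 m0.
  have fh : {ae P, forall w, forall b j : nat,
     M w (crossing X2 X1 Y1 j%:R b%:R) \is a fin_num /\
     M w (crossing X2 Y1 X1 j%:R b%:R) \is a fin_num}.
    exact: (crossings_fin hM mX2 mX1 mY1 zX2 zX1 zY1 up_h down_h).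
  have fv : {ae P, forall w, forall b j : nat,
     M w (crossing Y1 X2 Y2 j%:R b%:R) \is a fin_num /\
     M w (crossing Y1 Y2 X2 j%:R b%:R) \is a fin_num}.
    exact: (crossings_fin hM mY1 mX2 mY2 vY1 vX2 vY2 up_v down_v).
  case: (hM) => _ _ marg1 marg2.
  move: (ae_and (ae_and (poisson_integer l0 hX) (poisson_integer l0 hY))
    (ae_and (ae_and fh fv) (ae_and marg1 marg2))).
  apply: filterS => w [[[x hx] [y hy]] [[{}fh {}fv] [h1 h2]]].
  have := divergence (M w) n m.
  have -> : rectangle X1 X2 n m = box2 n m `*` setT.
    by apply/seteqP; split => p /=; [move=> /box2E|move=> [/box2E]].
  have -> : rectangle Y1 Y2 n m = setT `*` box2 n m.
    by apply/seteqP; split => p /=; [move=> /box2E|move=> [_ /box2E]].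
  rewrite h1 // h2 // /D hx hy /=.
  rewrite !strip_sum //; do ?[by move=> j; have [] := fh n j
    |by move=> j; have [] := fh 0 j|by move=> j; have [] := fv m j
    |by move=> j; have [] := fv 0 j].
  rewrite -!EFinD => -[] id; rewrite /h /v /flow !sumrB /=.
  by rewrite mulr0n; exact: balance.
- move=> n; have [->|n0] := posnP n.
    by apply: van0 => m w; rewrite D0 ?eqxx // mul0r.
  apply: (poisson_difference_vanishes n0) => m m0; exact: poisson_box2.
- move=> n; have [->|n0] := posnP n.
    by apply: van0 => m w; rewrite D0 ?eqxx ?orbT // mul0r.
  apply: (poisson_difference_vanishes n0) => m m0; rewrite mulnC;
    exact: poisson_box2.
- move=> r r0; apply: difference_large => //.
  + by rewrite -mulnn; apply: poisson_box2 => //; rewrite muln_gt0.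
  + by rewrite -mulnn; apply: poisson_box2 => //; rewrite muln_gt0.
  + exact: (independent_pairC (independent_counts hind _ _)).
Qed.

End dimension_two.

Unset Implicit Arguments.
Set Strict Implicit.
Set Printing Implicit Defensive.

Theorem corollary9 (R : realType) (dO : measure_display)
    (Omega : measurableType dO) (P : probability Omega R)
    (d : nat) (hd : d = 1%N \/ d = 2%N)
    (Pi Pi' : R.-ker Omega ~> d.-tuple R)
    (hPi : unit_poisson_process P Pi)
    (hPi' : unit_poisson_process P Pi')
    (hind : independent_processes P Pi Pi')
    (M : R.-ker Omega ~> (d.-tuple R * d.-tuple R)%type)
    (hM : translation_invariant_matching P Pi' Pi M) :
  (\int[P]_w (total_distance (M w) `^ (d%:R / 2)) = +oo)%E.
Proof.
case: hd => hd'; subst d.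
- exact: (dimension_one hPi hPi' hind hM).
- exact: (dimension_two hPi hPi' hind hM).
Qed.
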